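(* Let $|\nu|\le\frac12$, $0\le\alpha<1$ and $\beta\ge0$. Then the radius of $\beta$-uniform convexity of order $\alpha$, $r_{w_\nu}^{\beta-uc(\alpha)}$, of the function $w_\nu$ is the smallest positive root $r$ of the equation $$2(1-\alpha)-(1+\beta)\left(1+\nu-\sqrt r\,\frac{(2-\nu)\mathbf{H}_\nu'(\sqrt r)+\sqrt r\,\mathbf{H}_\nu''(\sqrt r)}{(1-\nu)\mathbf{H}_\nu(\sqrt r)+\sqrt r\,\mathbf{H}_\nu'(\sqrt r)}\right)=0.$$ Moreover, $r_{w_\nu}^{\beta-uc(\alpha)}<r_{w_\nu}^{c}<\sigma_{\nu,1}<h_{\nu,1}$, where $h_{\nu,1}$ and $\sigma_{\nu,1}$ denote the first positive zeros of $\mathbf{H}_\nu$ and $w_\nu'$, respectively, and $r_{w_\nu}^{c}$ is the radius of convexity of $w_\nu$.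
   Context: Primes on functions denote derivatives. The Struve function of the first kind is $$\mathbf{H}_\nu(z)=\frac{\left(\frac z2\right)^{\nu+1}}{\sqrt{\frac{\pi}{4}}\,\Gamma\left(\nu+\frac32\right)}\,{}_1F_2\left(1;\tfrac32,\nu+\tfrac32;-\tfrac{z^2}{4}\right).$$ The normalized function is $w_\nu(z)=\sqrt\pi\,2^\nu z^{\frac{1-\nu}{2}}\,\Gamma\left(\nu+\frac32\right)\mathbf{H}_\nu(\sqrt z)=z\,{}_1F_2\left(1;\frac32,\nu+\frac32;-\frac{z}{4}\right)$. For $f(z)=z+\sum_{n\ge2}a_nz^n$ with radius of convergence $r_f\in(0,\infty]$ and $U(r)=\{z\in\mathbb{C}:|z|<r\}$, the radius of convexity is $$r_f^{c}=\sup\left\{r\in(0,r_f):\Re\left(1+\frac{zf''(z)}{f'(z)}\right)>0,\ z\in U(r)\right\},$$ and for $\beta\ge0$, $\alpha\in[0,1)$ the radius of $\beta$-uniform convexity of order $\alpha$ is $$r_f^{\beta-uc(\alpha)}=\sup\left\{r\in(0,r_f):\Re\left(1+\frac{zf''(z)}{f'(z)}\right)>\beta\left|\frac{zf''(z)}{f'(z)}\right|+\alpha,\ z\in U(r)\right\}.$$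
   Formalization: The last inequality is stated as σ_{ν,1} < h_{ν,1}² instead of σ_{ν,1} < h_{ν,1} (false, e.g. ν=1/2: π² > 2π), and the strict inequality r^{β-uc(α)} < r^c is claimed only when α>0 or β>0, since the two radii coincide for α=β=0. *)

(* Defs.v *)
From HB Require Import structures.
From mathcomp Require Import all_boot all_order all_algebra.
From mathcomp Require Import all_classical all_reals all_analysis.
From mathcomp Require Import complex.

Set Implicit Arguments.
Unset Strict Implicit.
Unset Printing Implicit Defensive.

Import Order.TTheory GRing.Theory Num.Theory numFieldNormedType.Exports.
Local Open Scope classical_set_scope.
Local Open Scope ring_scope.
Local Open Scope complex_scope.

(* R[i] viewed as a numFieldType, so that it gets the library's topology and
   normed module structure; derive1 over it is then the complex derivative. *)
Definition Cx (R : realType) : numFieldType := R[i].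

(* Euler's integral; this is the Gamma function only for x > 0. *)
Definition Gamma (R : realType) (x : R) : R :=
  \int[@lebesgue_measure R]_(t in `]0, +oo[) (t `^ (x - 1) * expR (- t)).

Definition pochhammer (K : numFieldType) (a : K) (n : nat) : K :=
  \prod_(k < n) (a + k%:R).

Definition hyp1F2 (K : numFieldType) (a b c z : K) : K :=
  limn (series (fun n => pochhammer a n / (pochhammer b n * pochhammer c n)
                         * (z ^+ n / n`!%:R))).

(* The Struve function of the first kind on the positive half-line, where the
   power (x / 2) ^ (nu + 1) is the usual real one. *)
Definition struveH (R : realType) (nu x : R) : R :=
  (x / 2) `^ (nu + 1) / (Num.sqrt (pi / 4) * Gamma (nu + 3 / 2))
  * hyp1F2 1 (3 / 2) (nu + 3 / 2) (- (x ^+ 2 / 4)).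

(* w_nu on the whole complex plane.  The other expression,
   sqrt pi 2^nu z^((1-nu)/2) Gamma(nu + 3/2) H_nu(sqrt z), reduces to this one
   off z = 0, whatever common branch is used for the powers. *)
Definition struvew (R : realType) (nu : R) (z : Cx R) : Cx R :=
  z * hyp1F2 1 (3 / 2) (nu + 3 / 2)%:C (- (z / 4)).

Section Radii.
Context {R : realType}.
Implicit Types (f : Cx R -> Cx R) (r : R).

(* Radius of convergence of the power series (centred at 0) representing f. *)
Definition cvg_radius f : \bar R :=
  ereal_sup [set r%:E | r in [set r : R | 0 <= r /\
    exists a : nat -> Cx R, forall z : Cx R, `|z| < r%:C ->
      series (fun n => a n * z ^+ n) @ \oo --> f z]].

(* z f''(z) / f'(z); the derivatives are complex ones. *)
Definition convexity_quotient f (z : Cx R) : Cx R :=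
  z * derive1 (derive1 f) z / derive1 f z.

(* Since division by 0 is total, the condition f'(z) != 0, under which the
   quotient is meaningful, has to be made explicit in the two radii below. *)
Definition convexity_radius f : \bar R :=
  ereal_sup [set r%:E | r in [set r : R |
    [/\ 0 < r, (r%:E < cvg_radius f)%E &
      forall z : Cx R, `|z| < r%:C ->
        derive1 f z != 0 /\ 0 < complex.Re (1 + convexity_quotient f z)]]].

Definition uniform_convexity_radius (beta alpha : R) f : \bar R :=
  ereal_sup [set r%:E | r in [set r : R |
    [/\ 0 < r, (r%:E < cvg_radius f)%E &
      forall z : Cx R, `|z| < r%:C ->
        derive1 f z != 0 /\
        beta * complex.Re `|convexity_quotient f z| + alpha
          < complex.Re (1 + convexity_quotient f z)]]].

Definition smallest_positive (P : R -> Prop) (r : R) : Prop :=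
  [/\ 0 < r, P r & forall s, 0 < s -> P s -> r <= s].

End Radii.

(* Equation in r > 0 for the radius of beta-uniform convexity of order alpha;
   r is a root only if the denominator does not vanish there. *)
Definition ucv_equation (R : realType) (nu alpha beta r : R) : Prop :=
  let x := Num.sqrt r in
  let H := struveH nu in
  let H' := derive1 H in
  let H'' := derive1 H' in
  let den := (1 - nu) * H x + x * H' x in
  den != 0 /\
  2 * (1 - alpha) - (1 + beta) *
    (1 + nu - x * (((2 - nu) * H' x + x * H'' x) / den)) = 0.

(* Main.v *)
Require Import Defs.
From mathcomp Require Import all_boot all_order all_algebra.
From mathcomp Require Import all_classical all_reals all_analysis.
From mathcomp Require Import measurable_realfun.
From mathcomp Require Import complex polyrcf ring lra zify.

Set Implicit Arguments.
Unset Strict Implicit.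
Unset Printing Implicit Defensive.

Import Order.TTheory GRing.Theory Num.Theory numFieldNormedType.Exports.
Local Open Scope ring_scope.
Local Open Scope complex_scope.

(** Put [mu = nu + 1/2], so that [0 <= mu <= 1], and write [w z = z g z] with
[g = 1F2(1; 3/2, mu + 1; -z/4)] and [f = w'].  Everything follows from one
inequality, [struve_bound]: if [f > 0] on [[0, r]] and [|z| <= r], then
[|f z| >= f r] and [|z f'(z) / f(z)| <= - r f'(r) / f(r)].  Let
[q = (1 - alpha) / (1 + beta)] and let [r] be the first positive zero of
[q f + x f'].  For [|z| < r] the inequality, applied with [|z|] as radius, gives
[|z f'(z) / f(z)| < q], hence [Re (1 + Q) >= 1 - |Q| > beta |Q| + alpha] for the
quotient [Q = z f'(z) / f(z)]; at [z = r] one has [Q = - q] and equality holds, so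
that [r] is the radius ([ucv_radius_csum]).  The radius of convexity is the case
[q = 1].  The order of the four numbers comes from Rolle's theorem: [z g] vanishes
at [0] and at the first zero of [g], so [f] vanishes before it; [z f] vanishes at
[0] and at the first zero of [f], so [f + z f'] vanishes before it, at a point
where [q f + z f' = (q - 1) f <= 0].  The powers of [x] in the Struve function
cancel in the equation for [r], which becomes [q f + r f' = 0]
([ucv_equation_rsum]).

The inequality holds for a product of factors [1 - z / s] with positive [s]
([prod_pos_roots_bound]) and survives limits ([csum_bound]), so [f] has to be
approximated by polynomials with only positive zeros.  For [|nu| < 1/2] the
Struve function is, up to a power, the sine transform of the increasing weight
[(1 - t ^ 2) ^ (nu - 1/2)] on [[0, 1]], and its zeros are real by an argument of
Polya.  A discrete version of that argument is carried out here: if the weights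
[a_k] are nonnegative and nondecreasing, and [0 < a_0] or [a_(n - 1) < a_n], then
[\sum_(k <= n) a_k sin (k t)] alternates in sign at the points
[2 m pi / (2 n + 1)] ([sum_sin_alternates]), so that, divided by [sin t],
it is a polynomial in [2 - 2 cos t] with only positive zeros.  The weights are
hypergeometric terms, for which a telescoping sum gives the coefficients in
closed form ([struve_sin_coef_rec]); after rescaling they converge to those of [g],
with an error of order [1 / n] controlled by a convergent majorant
([struve_poly_close]).  Rolle's theorem then passes from the
approximants of [z g] to those of its derivative [f]. *)

(** * Sine polynomials *)

(** The polynomial [P] with [sin (k t) = sin t * P (2 - 2 cos t)], a Chebyshev
polynomial of the second kind.  The variable [2 - 2 cos t] behaves like [t ^ 2] at
the origin, which is the argument of [g] up to scaling. *)
Fixpoint sin_poly (R : nzRingType) (k : nat) : {poly R} :=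
  if k is k'.+1 then
    if k' is k''.+1 then (2%:P - 'X) * sin_poly R k' - sin_poly R k'' else 1
  else 0.

Lemma sin_polySS (R : nzRingType) k :
  sin_poly R k.+2 = (2%:P - 'X) * sin_poly R k.+1 - sin_poly R k.
Proof. by []. Qed.

Lemma sin_poly_horner (R : realType) (t : R) k :
  sin t * (sin_poly R k).[2 - 2 * cos t] = sin (k%:R * t).
Proof.
have [] : sin t * (sin_poly R k).[2 - 2 * cos t] = sin (k%:R * t) /\
          sin t * (sin_poly R k.+1).[2 - 2 * cos t] = sin (k.+1%:R * t).
  elim: k => [|k [IH1 IH2]].
    by rewrite /= hornerE hornerC mulr0 mul0r sin0 mul1r mulr1.
  split=> //; rewrite sin_polySS !hornerE.
  have -> : k.+2%:R * t = k.+1%:R * t + t by rewrite -addn1 natrD; ring.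
  have E : k%:R * t = k.+1%:R * t - t by rewrite -addn1 natrD; ring.
  rewrite sinD; move: IH1; rewrite E sinB => IH1.
  rewrite mulrBr IH1.
  transitivity (2 * cos t * (sin t * (sin_poly R k.+1).[2 - 2 * cos t]) -
    (sin (k.+1%:R * t) * cos t - cos (k.+1%:R * t) * sin t)); first by ring.
  by rewrite IH2; ring.
by [].
Qed.

Lemma sin_poly_coef (R : comNzRingType) k j :
  (sin_poly R k)`_j = (-1) ^+ j * 'C(k + j, j.*2.+1)%:R.
Proof.
have [] : (forall j, (sin_poly R k)`_j = (-1) ^+ j * 'C(k + j, j.*2.+1)%:R) /\
  (forall j, (sin_poly R k.+1)`_j = (-1) ^+ j * 'C(k.+1 + j, j.*2.+1)%:R).
  elim: k => [|k [IH1 IH2]].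
    split=> i; first by rewrite coef0 add0n bin_small ?mulr0 // -addnn; lia.
    rewrite /= coef1; case: i => [|i] /=; first by rewrite expr0 mul1r.
    by rewrite bin_small ?mulr0 // -addnn; lia.
  split=> // i; rewrite sin_polySS coefB mulrBl coefB mul_polyC coefZ coefXM.
  rewrite IH2 IH1; case: i => [|i].
    rewrite eqxx !addn0 double0 !bin1 expr0.
    by rewrite -addn2 -(addn1 k) !natrD; ring.
  rewrite [_ == 0%N]/= IH2 /= !addSn !addnS doubleS.
  have -> : 'C((k + i).+3, i.*2.+3) =
      ('C((k + i).+2, i.*2.+3) + 'C((k + i).+1, i.*2.+2)
       + 'C((k + i).+1, i.*2.+1))%N by rewrite binS (binS _ i.*2.+1) addnA.
  have -> : 'C((k + i).+2, i.*2.+3) =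
    ('C((k + i).+1, i.*2.+3) + 'C((k + i).+1, i.*2.+2))%N by rewrite binS.
  by rewrite !natrD exprS; ring.
by [].
Qed.

Lemma sum_sin_abel (R : realType) (a : nat -> R) t n :
  2 * sin (t / 2) * (\sum_(k < n.+1) a k * sin (k%:R * t)) =
  a 0 * cos (t / 2) + \sum_(k < n) (a k.+1 - a k) * cos ((k%:R + 1 / 2) * t)
  - a n * cos ((n%:R + 1 / 2) * t).
Proof.
elim: n => [|n IH].
  rewrite big_ord1 big_ord0 mul0r sin0 !mulr0 addr0 add0r.
  by rewrite [1 / 2 * t]mulrC mul1r subrr.
rewrite big_ord_recr mulrDr IH [in RHS]big_ord_recr /=.
have -> : (n.+1%:R + 1 / 2) * t = n.+1%:R * t + t / 2 by field.
have -> : (n%:R + 1 / 2) * t = n.+1%:R * t - t / 2.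
  by rewrite -addn1 natrD; field.
by rewrite cosB cosD; ring.
Qed.

Lemma cos_natpi (R : realType) m : cos (m%:R * pi) = (-1) ^+ m :> R.
Proof.
elim: m => [|m IH]; first by rewrite mul0r cos0.
by rewrite -addn1 natrD mulrDl mul1r cosDpi IH addn1 exprS mulN1r.
Qed.

Lemma sin_natpi (R : realType) m : sin (m%:R * pi) = 0 :> R.
Proof.
elim: m => [|m IH]; first by rewrite mul0r sin0.
by rewrite -addn1 natrD mulrDl mul1r sinDpi IH oppr0.
Qed.

Lemma cos_lt1 (R : realType) (t : R) : 0 < t < pi -> cos t < 1.
Proof.
move=> /andP[t0 tpi]; rewrite -(cos0 R) ltr_cos // in_itv /=; apply/andP; split => //.
- exact: pi_ge0.
- exact: ltW.
- exact: ltW.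
Qed.

(** Abscissae at which [(n + 1/2) t] is an integral multiple of pi, so that the
boundary term of the Abel summation has the largest possible modulus. *)
Definition node (R : realType) (n m : nat) : R := m%:R * (2 * pi) / n.*2.+1%:R.

Lemma node_itv (R : realType) n m : (0 < m <= n)%N -> 0 < node R n m < pi.
Proof.
move=> /andP[m0 mn]; have p0 := pi_gt0 R; apply/andP; split.
  by rewrite divr_gt0 ?ltr0n// mulr_gt0 ?ltr0n// mulr_gt0.
rewrite ltr_pdivrMr ?ltr0n // mulrCA mulrA [ltRHS]mulrC ltr_pM2r //.
by rewrite -natrM ltr_nat; lia.
Qed.

Lemma node_lt (R : realType) n m m' : (m < m')%N -> node R n m < node R n m'.
Proof.
move=> mm; have p0 := pi_gt0 R; rewrite /node.
by rewrite ltr_pM2r ?invr_gt0 ?ltr0n// ltr_pM2r ?mulr_gt0// ltr_nat.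
Qed.

Lemma node_half (R : realType) n m :
  (n%:R + 1 / 2) * node R n m = m%:R * pi.
Proof.
have E : n.*2.+1%:R = 2 * n%:R + 1 :> R by rewrite -natr1 -mul2n natrM.
rewrite /node E; field.
by rewrite -E pnatr_eq0.
Qed.

(** The Abel summation writes [2 sin (t/2)] times the sum as a combination of
cosines whose positive coefficients add up to [a n], minus [a n (-1) ^ m]; the
latter dominates. *)
Lemma sum_sin_alternates (R : realType) (a : nat -> R) n m :
    (0 < m <= n)%N -> 0 <= a 0 -> (forall k, (k < n)%N -> a k <= a k.+1) ->
    0 < a 0 \/ a n.-1 < a n ->
  (-1) ^+ m * \sum_(k < n.+1) a k * sin (k%:R * node R n m) < 0.
Proof.
move=> mn a0 amono astrict; set t := node R n m.
have /andP[t0 tpi] : 0 < t < pi by exact: node_itv.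
have half : (n%:R + 1 / 2) * t = m%:R * pi by exact: node_half.
clearbody t; have s0 : 0 < sin (t / 2).
  by apply: sin_gt0_pi; rewrite divr_gt0 //= ltr_pdivrMr // mulr_natr mulr2n ltr_wpDr// pi_ge0.
rewrite -(pmulr_rlt0 _ (mulr_gt0 (ltr0Sn R 1) s0)) mulrCA sum_sin_abel.
rewrite half cos_natpi mulrBr mulrCA -expr2 -exprM mulnC exprM sqrrN expr1n.
rewrite expr1n mulr1.
have sgn (x : R) : `|x| <= 1 -> (-1) ^+ m * x <= 1.
  by move=> x1; apply: le_trans (ler_norm _) _; rewrite normrM normrX normrN1 expr1n mul1r.
have cle (x : R) : (-1) ^+ m * cos x <= 1.
  by apply: sgn; rewrite ler_norml cos_geN1 cos_le1.
have tel : a 0 + \sum_(k < n) (a k.+1 - a k) = a n.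
  by rewrite -(big_mkord xpredT (fun k => a k.+1 - a k)) telescope_sumr // addrC subrK.
have le1 k : (k < n)%N ->
    (-1) ^+ m * ((a k.+1 - a k) * cos ((k%:R + 1 / 2) * t)) <= a k.+1 - a k.
  move=> kn; rewrite mulrCA -[leRHS]mulr1 ler_wpM2l //.
  by rewrite subr_ge0 amono.
rewrite subr_lt0 mulrDr -[ltRHS]tel.
case: astrict => [a0p|alast].
  apply: ltr_leD.
    rewrite mulrCA -[ltRHS]mulr1 ltr_pM2l //.
    have c1 : `|cos (t / 2)| < 1.
      have h1 : t / 2 < pi by lra.
      have h2 : cos (t / 2) < 1 by apply: cos_lt1; rewrite h1 divr_gt0.
      rewrite ltr_norml h2 andbT; apply: lt_le_trans (cos_ge0_pihalf _); first by lra.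
      by apply/andP; split; lra.
    by apply: le_lt_trans (ler_norm _) _; rewrite normrM normrX normrN1 expr1n mul1r.
  by rewrite mulr_sumr; apply: ler_sum => k _; apply: le1.
case: n mn amono alast half tel le1 => [|n] mn amono alast half tel le1.
  by move: mn; rewrite leqn0 => /andP[mp /eqP m0]; rewrite m0 in mp.
apply: ler_ltD; first by rewrite mulrCA -[leRHS]mulr1 ler_wpM2l.
rewrite mulr_sumr !big_ord_recr /=; apply: ler_ltD.
  by apply: ler_sum => k _; apply: le1; apply: ltn_trans (ltn_ord k) _.
rewrite mulrCA -[ltRHS]mulr1 ltr_pM2l ?subr_gt0 //.
(* the last half-integral multiple of the node is [m pi - t] *)
have -> : (n%:R + 1 / 2) * t = m%:R * pi - t.
  by rewrite -half -natr1; ring.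
rewrite cosB sin_natpi mul0r addr0 cos_natpi mulrA -expr2 -exprM mulnC exprM.
by rewrite sqrrN expr1n expr1n mul1r cos_lt1 // t0.
Qed.

(** * Sines with hypergeometric weights *)

(** Discrete analogue of a multiple of [(1 - t ^ 2) ^ (mu - 1)] at [t = k / n],
with the value [1] at [k = n].  The factors are adjusted so that the coefficients of
[\sum_k struve_weight mu n k * sin (k t) / sin t], in powers of [2 - 2 cos t], have
a closed form. *)
Definition struve_weight (R : realType) (mu : R) (n k : nat) : R :=
  \prod_(i < n - k) ((i%:R + mu) * (2 * n%:R - i%:R) /
    ((i%:R + 1) * (2 * n%:R - i%:R - 1 + mu))).

Lemma struve_weight_den (R : realType) (mu : R) n i : 0 <= mu -> (i < n)%N ->
  0 < (i%:R + 1) * (2 * n%:R - i%:R - 1 + mu).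
Proof.
move=> mu0 lt_in; have h : i%:R + 1 <= n%:R :> R by rewrite natr1 ler_nat.
have i0 : 0 <= i%:R :> R by [].
apply: mulr_gt0; first by lra.
have n0 : 1 <= n%:R :> R by rewrite ler1n (leq_ltn_trans _ lt_in).
by clear lt_in; lra.
Qed.

Lemma struve_weight_fac_ge0 (R : realType) (mu : R) n i : 0 <= mu -> (i < n)%N ->
  0 <= (i%:R + mu) * (2 * n%:R - i%:R).
Proof.
move=> mu0 lt_in; have h : i%:R + 1 <= n%:R :> R by rewrite natr1 ler_nat.
have i0 : 0 <= i%:R :> R by [].
by clear lt_in; apply: mulr_ge0; lra.
Qed.

Lemma struve_weight_ge0 (R : realType) (mu : R) n k : 0 <= mu -> 0 <= struve_weight mu n k.
Proof.
move=> mu0; apply: prodr_ge0 => i _.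
have lt_in : (i < n)%N by apply: leq_trans (ltn_ord i) (leq_subr _ _).
by rewrite divr_ge0 ?struve_weight_fac_ge0// ltW// struve_weight_den.
Qed.

Lemma struve_weightnn (R : realType) (mu : R) n : struve_weight mu n n = 1.
Proof. by rewrite /struve_weight subnn big_ord0. Qed.

Lemma struve_weight_rec (R : realType) (mu : R) n k : 0 <= mu -> (k < n)%N ->
  struve_weight mu n k * ((n%:R - k%:R) * (n%:R + k%:R + mu)) =
  struve_weight mu n k.+1 * ((n%:R - k%:R - 1 + mu) * (n%:R + k%:R + 1)).
Proof.
move=> mu0 kn; rewrite /struve_weight -(subnSK kn) big_ord_recr /= -mulrA; congr (_ * _).
have lt_in : (n - k.+1 < n)%N by lia.
have := struve_weight_den mu0 lt_in.
rewrite natrB // -natr1; move: (n%:R : R) (k%:R : R) => x y.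
set d := _ * _ => d0.
have -> : (x - y) * (x + y + mu) = d by rewrite /d; ring.
by rewrite divfK ?gt_eqF//; ring.
Qed.

(** The recurrence moves the weights upwards since the difference of its two
factors is [(2 k + 1) (1 - mu)]. *)
Lemma struve_weight_le (R : realType) (mu : R) n k : 0 <= mu <= 1 -> (k < n)%N ->
  struve_weight mu n k <= struve_weight mu n k.+1.
Proof.
move=> /andP[mu0 mu1] kn; have k0 : 0 <= k%:R :> R by [].
have h : k%:R + 1 <= n%:R :> R by rewrite natr1 ler_nat.
have p0 : 0 < (n%:R - k%:R) * (n%:R + k%:R + mu) by apply: mulr_gt0; lra.
rewrite -(ler_pM2r p0) struve_weight_rec // ler_wpM2l ?struve_weight_ge0//.
have : 0 <= (2 * k%:R + 1) * (1 - mu) by apply: mulr_ge0; lra.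
clear; move: (n%:R : R) (k%:R : R) => x y; nra.
Qed.

(** For [mu = 0] all weights but the last one vanish. *)
Lemma struve_weight_strict (R : realType) (mu : R) n : 0 <= mu -> (0 < n)%N ->
  0 < struve_weight mu n 0 \/ struve_weight mu n n.-1 < struve_weight mu n n.
Proof.
rewrite le_eqVlt => /predU1P[<-|mu0] n0; [right|left].
  rewrite struve_weightnn /struve_weight.
  have -> : (n - n.-1 = 1)%N by lia.
  by rewrite big_ord1 /= addr0 !mul0r ltr01.
apply: prodr_gt0 => i _.
have lt_in : (i < n)%N by rewrite (leq_trans (ltn_ord i))// leq_subr.
have h : i%:R + 1 <= n%:R :> R by rewrite natr1 ler_nat.
have i0 : 0 <= i%:R :> R by [].
by rewrite divr_gt0 ?struve_weight_den ?ltW//; apply: mulr_gt0; lra.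
Qed.

Lemma natr_bin_up (R : realType) k j : (0 < j)%N -> (j <= k)%N ->
  (2 * j%:R + 1) * (2 * j%:R) * 'C(k + j, j.*2.+1)%:R =
  (k%:R + j%:R) * (k%:R - j%:R) * 'C(k + j - 1, j.*2 - 1)%:R :> R.
Proof.
move=> j0 jk.
have E1 : (j.*2.+1 * 'C(k + j, j.*2.+1) = (k + j) * 'C(k + j - 1, j.*2))%N.
  by rewrite -mul_bin_diag subn1.
have E2 : (j.*2 * 'C(k + j - 1, j.*2) = (k - j) * 'C(k + j - 1, j.*2 - 1))%N.
  have := mul_bin_left (k + j - 1) (j.*2 - 1).
  rewrite (_ : (j.*2 - 1).+1 = j.*2); last by lia.
  by move=> ->; congr (_ * _)%N; lia.
move/(congr1 (fun i => i%:R : R)): E1; move/(congr1 (fun i => i%:R : R)): E2.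
rewrite !natrM -natr1 -mul2n natrM natrD natrB // => E2 E1.
by rewrite mulrAC E1 -[RHS]mulrA -E2; ring.
Qed.

Lemma natr_bin_shift (R : realType) k j : (0 < j)%N -> (j <= k)%N ->
  (k%:R + 1 - j%:R) * 'C(k + j, j.*2 - 1)%:R =
  (k%:R + j%:R) * 'C(k + j - 1, j.*2 - 1)%:R :> R.
Proof.
move=> j0 jk.
have E : ((k + 1 - j) * 'C(k + j, j.*2 - 1) = (k + j) * 'C(k + j - 1, j.*2 - 1))%N.
  have := mul_bin_down (k + j) (j.*2 - 1); rewrite -subn1 => ->.
  by congr (_ * _)%N; lia.
move/(congr1 (fun i => i%:R : R)): E.
by rewrite !natrM natrD natrB ?natrD //; lia.
Qed.

Definition sin_coef (R : realType) (a : nat -> R) (n j : nat) : R :=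
  \sum_(k < n.+1) a k * 'C(k + j, j.*2.+1)%:R.

(** Creative telescoping: [j] times the difference of the two summands is half of
[G (k + 1) - G k] for an explicit [G] that vanishes at both ends. *)
Lemma struve_sin_coef_rec (R : realType) (mu : R) n j : 0 <= mu -> (0 < j)%N ->
  2 * (2 * j%:R + 1) * (mu + j%:R) * sin_coef (struve_weight mu n) n j =
  (n%:R - j%:R) * (n%:R + j%:R + mu) * sin_coef (struve_weight mu n) n j.-1.
Proof.
move=> mu0 j0; set a := struve_weight mu n.
have j1 : j%:R != 0 :> R by rewrite pnatr_eq0 -lt0n.
apply/eqP; rewrite -subr_eq0 -(inj_eq (mulfI j1)) mulr0; apply/eqP.
(* G' k is G k.+1 rewritten by the recurrence of the weights; unlike G k.+1 it
   vanishes visibly for k = n *)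
pose G k : R := - ((n%:R + k%:R) * (n%:R - k%:R + mu)) * a k *
   ((k%:R - j%:R) * 'C(k + j - 1, j.*2 - 1)%:R).
pose G' k : R := - ((n%:R - k%:R) * (n%:R + k%:R + mu)) * a k *
   ((k%:R + 1 - j%:R) * 'C(k + j, j.*2 - 1)%:R).
have GG k : (k < n)%N -> G' k = G k.+1.
  move=> kn; rewrite /G /G' -!natr1 (_ : (k.+1 + j - 1 = k + j)%N); last by lia.
  have := struve_weight_rec mu0 kn; rewrite -/a => E.
  rewrite mulNr [_ * a k]mulrC E; ring.
rewrite /sin_coef !mulr_sumr -sumrB mulr_sumr.
transitivity (2^-1 * \sum_(k < n.+1) (G' k - G k)).
  rewrite mulr_sumr; apply: eq_bigr => k _.
  rewrite (_ : (k + j.-1 = k + j - 1)%N); last by lia.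
  rewrite (_ : (j.-1.*2.+1 = j.*2 - 1)%N); last by lia.
  rewrite /G /G'; case: (leqP j k) => jk; last first.
    have -> : 'C(k + j, j.*2.+1) = 0%N by rewrite bin_small; lia.
    have -> : 'C(k + j - 1, j.*2 - 1) = 0%N by rewrite bin_small; lia.
    case: (ltnP k.+1 j) => kj.
      have -> : 'C(k + j, j.*2 - 1) = 0%N by rewrite bin_small; lia.
      by ring.
    by have -> : j%:R = k%:R + 1 :> R; [rewrite natr1; congr (_%:R); lia|ring].
  have := natr_bin_shift R j0 jk; have := natr_bin_up R j0 jk.
  move: ('C(k + j, j.*2.+1)%:R) ('C(k + j, j.*2 - 1)%:R)
     ('C(k + j - 1, j.*2 - 1)%:R) => b1 b2 c E1 ->.
  transitivity (a k * ((mu + j%:R) * ((2 * j%:R + 1) * (2 * j%:R) * b1) -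
    j%:R * ((n%:R - j%:R) * (n%:R + j%:R + mu) * c))); first by ring.
  by rewrite E1; clear; field.
rewrite big_split /= sumrN big_ord_recr /= [X in _ - X]big_ord_recl /=.
have -> : G' n = 0 by rewrite /G' subrr !(mul0r, oppr0).
have -> : G 0 = 0.
  rewrite /G; case: (ltnP 1 j) => j2; last first.
    by have -> : j = 1%N; [lia|rewrite [in X in 'C(X, _)]addnK bin0n !mulr0].
  by rewrite bin_small ?mulr0//; lia.
rewrite addr0 add0r (eq_bigr (fun k : 'I_n => G k.+1)); last by move=> k _; apply: GG.
by rewrite subrr mulr0.
Qed.

(** * Real-rooted approximants *)

(** Sign changes locate the zeros of [p]; together with the zero at the origin
they separate, by Rolle's theorem, as many positive zeros of the derivative of
['X * p] as its degree. *)
Lemma alternating_derivX_prod (R : rcfType) (p : {poly R}) n (x : nat -> R) :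
    (size p <= n.+1)%N -> p.[0] = 1 -> 0 < x 0 ->
    (forall m, (m < n)%N -> x m < x m.+1) ->
    (forall m, (m <= n)%N -> 0 < (-1) ^+ m * p.[x m]) ->
  exists2 s : seq R, (forall y, y \in s -> 0 < y) &
    ('X * p)^`() = \prod_(y <- s) (1 - y^-1 *: 'X).
Proof.
move=> szp p0 x0 xmono alt.
have rt m : {r | (m < n)%N -> x m < r < x m.+1 /\ p.[r] = 0}.
  case: (ltnP m n) => mn; last by exists 0.
  have : p.[x m] * p.[x m.+1] < 0.
    have := mulr_gt0 (alt m (ltnW mn)) (alt m.+1 mn).
    rewrite exprS mulN1r mulNr mulrN oppr_gt0 mulrACA -expr2 -exprM mulnC exprM.
    by rewrite sqrrN expr1n expr1n mul1r.
  move/(poly_ivtoo (ltW (xmono m mn))) => [r]; rewrite in_itv /= => rI rr.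
  by exists r => _; split => //; apply/rootP.
pose r m := if m is m'.+1 then sval (rt m') else 0.
have r_root m : (m <= n)%N -> ('X * p).[r m] = 0.
  case: m => [|m] mn; first by rewrite hornerM hornerX mul0r.
  by rewrite hornerM /=; case: (rt m) => y /= /(_ mn) [_ ->]; rewrite mulr0.
have r_lt m : (m < n)%N -> r m < r m.+1.
  move=> mn; rewrite /=; case: (rt m) => y /= /(_ mn) [/andP[xy _] _].
  case: m mn xy => [|m] mn xy /=; first exact: lt_trans xy.
  case: (rt m) => z /= /(_ (ltnW mn)) [/andP[_ zx] _].
  exact: lt_trans xy.
have r_le i j : (i <= j)%N -> (j <= n)%N -> r i <= r j.
  elim: j => [|j IH]; first by rewrite leqn0 => /eqP->.
  rewrite leq_eqVlt => /predU1P[->//|ij] jn.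
  exact: le_trans (IH ij (ltnW jn)) (ltW (r_lt _ jn)).
set q := ('X * p)^`().
have st m : {y : R | (m < n)%N -> r m < y < r m.+1 /\ q.[y] = 0}.
  case: (ltnP m n) => mn; last by exists 0.
  have E : ('X * p).[r m] = ('X * p).[r m.+1] by rewrite !r_root // ltnW.
  by have [c] := poly_rolle (r_lt m mn) E; rewrite in_itv /= => cI qc; exists c.
pose t m := sval (st m).
have tP m : (m < n)%N -> r m < t m < r m.+1 /\ q.[t m] = 0.
  by move=> mn; rewrite /t; case: (st m) => y /= /(_ mn).
have t_lt i j : (i < j)%N -> (j < n)%N -> t i < t j.
  move=> ij jn; have [/andP[_ h1] _] := tP i (ltn_trans ij jn).
  have [/andP[h2 _] _] := tP j jn.
  exact: lt_le_trans h1 (le_trans (r_le _ _ ij (ltnW jn)) (ltW h2)).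
pose s := [seq t m | m <- iota 0 n].
have s_gt0 y : y \in s -> 0 < y.
  move=> /mapP[m]; rewrite mem_iota add0n /= => mn ->.
  have [/andP[h _] _] := tP m mn.
  exact: le_lt_trans (r_le 0%N m (leq0n m) (ltnW mn)) h.
have s_uniq : uniq s.
  rewrite map_inj_in_uniq ?iota_uniq // => i j; rewrite !mem_iota !add0n /= => iN jN tij.
  case: (ltngtP i j) => // ij.
    by have := t_lt i j ij jN; rewrite tij ltxx.
  by have := t_lt j i ij iN; rewrite tij ltxx.
have s_root : all (root q) s.
  apply/allP => y /mapP[m]; rewrite mem_iota add0n /= => mn ->.
  by apply/rootP; have [] := tP m mn.
have q0 : q.[0] = 1.
  by rewrite /q derivM derivX mul1r hornerD hornerM hornerX mul0r addr0.
have qN0 : q != 0 by apply/eqP => q00; move: q0; rewrite q00 horner0 => /eqP; rewrite eq_sym oner_eq0.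
have szq : size q = (size s).+1.
  apply/eqP; rewrite eqn_leq max_poly_roots // andbT size_map size_iota.
  have pN0 : p != 0 by apply/eqP => p00; move: p0; rewrite p00 horner0 => /eqP; rewrite eq_sym oner_eq0.
  rewrite -ltnS; apply: leq_trans (lt_size_deriv _) _; first by rewrite mulf_neq0 ?polyX_eq0.
  by rewrite mulrC size_mulX // ltnS.
exists s => //.
have Eq := all_roots_prod_XsubC szq s_root; rewrite uniq_rootsE in Eq.
rewrite (Eq s_uniq).
have L : lead_coef q * \prod_(y <- s) (- y) = 1.
  rewrite -[RHS]q0 [in RHS](Eq s_uniq) hornerZ horner_prod; congr (_ * _).
  by apply: eq_bigr => y _; rewrite hornerXsubC sub0r.
have -> : \prod_(y <- s) (1 - y^-1 *: 'X) =
    (\prod_(y <- s) (- y))^-1 *: \prod_(y <- s) ('X - y%:P).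
  elim: s s_gt0 {s_uniq s_root szq Eq L} => [|y s IH] s_gt0.
    by rewrite !big_nil invr1 scale1r.
  rewrite !big_cons IH; last by move=> z zs; apply: s_gt0; rewrite inE zs orbT.
  have y0 : y != 0 by rewrite gt_eqF // s_gt0 // mem_head.
  have -> : 1 - y^-1 *: 'X = (- y)^-1 *: ('X - y%:P).
    by rewrite scalerBr invrN !scaleNr opprK addrC -[_ *: y%:P]mul_polyC -polyCM mulVf ?polyC1.
  by rewrite -scalerAl -scalerAr scalerA invfM.
have D0 : \prod_(y <- s) (- y) != 0.
  by apply/eqP => h; move: L; rewrite h mulr0 => /eqP; rewrite eq_sym oner_eq0.
by congr (_ *: _); apply: (mulIf D0); rewrite L mulVf.
Qed.

(** Absolute values of the coefficients of [1F2(1; 3/2, mu + 1; - z / 4)]. *)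
Definition struve_coef (R : realType) (mu : R) (j : nat) : R :=
  \prod_(i < j) (4 * (mu + i.+1%:R) * (i.+1%:R + 1 / 2))^-1.

(** Ratio of the coefficients of the rescaled sine polynomial to those of its
limit. *)
Definition approx_factor (R : realType) (mu : R) (n j : nat) : R :=
  \prod_(i < j) ((n%:R - i.+1%:R) * (n%:R + i.+1%:R + mu) / (n%:R * n.+1%:R)).

Definition struve_poly (R : realType) (mu : R) (n : nat) : {poly R} :=
  \poly_(j < n) ((-1) ^+ j * (struve_coef mu j * approx_factor mu n j)).

Lemma sin_coef_closed (R : realType) (mu : R) n j : 0 <= mu -> (0 < n)%N ->
  sin_coef (struve_weight mu n) n j = sin_coef (struve_weight mu n) n 0 *
    ((n%:R * n.+1%:R) ^+ j * (struve_coef mu j * approx_factor mu n j)).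
Proof.
move=> mu0 n0; elim: j => [|j IH].
  by rewrite /struve_coef /approx_factor !big_ord0 expr0 !mulr1.
rewrite /struve_coef /approx_factor !big_ord_recr /= -/(struve_coef mu j) -/(approx_factor mu n j).
have := struve_sin_coef_rec n mu0 (ltn0Sn j); rewrite /= IH.
have j0 : 0 < j.+1%:R :> R by [].
have nn : n%:R != 0 :> R by rewrite pnatr_eq0 -lt0n.
have mn : n.+1%:R != 0 :> R by rewrite pnatr_eq0.
rewrite exprS; move: (sin_coef _ _ _) (sin_coef _ _ _) (_ ^+ j).
move: (struve_coef _ _) (approx_factor _ _ _).
move: (j.+1%:R) (n.+1%:R) (n%:R) j0 nn mn => x m k x0 k0 m0 A B C D F H.
have E : 0 < 2 * (2 * x + 1) * (mu + x) by apply: mulr_gt0; nra.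
apply: (mulfI (lt0r_neq0 E)); rewrite H; field.
by rewrite k0 m0 /=; apply/andP; split; rewrite gt_eqF //; lra.
Qed.

Lemma sin_coef0_gt0 (R : realType) (mu : R) n : 0 <= mu -> (0 < n)%N ->
  0 < sin_coef (struve_weight mu n) n 0.
Proof.
move=> mu0 n0; rewrite /sin_coef big_ord_recr /= struve_weightnn mul1r addn0 bin1.
rewrite ltr_wpDl ?ltr0n // sumr_ge0 // => k _.
by rewrite mulr_ge0 // struve_weight_ge0.
Qed.

Lemma struve_poly_sin_poly (R : realType) (mu : R) n y : 0 <= mu -> (0 < n)%N ->
  (\sum_(k < n.+1) struve_weight mu n k *: sin_poly R k).[y] =
  sin_coef (struve_weight mu n) n 0 * (struve_poly mu n).[n%:R * n.+1%:R * y].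
Proof.
move=> mu0 n0; set Q := \sum_(k < n.+1) _.
have Qc j : Q`_j = (-1) ^+ j * sin_coef (struve_weight mu n) n j.
  rewrite /Q coef_sum /sin_coef mulr_sumr; apply: eq_bigr => k _.
  by rewrite coefZ sin_poly_coef mulrCA.
have szQ : (size Q <= n)%N.
  apply/leq_sizeP => j nj; rewrite Qc /sin_coef big1 ?mulr0 // => k _.
  by rewrite bin_small ?mulr0 //; have := ltn_ord k; lia.
rewrite (horner_coef_wide _ szQ) /struve_poly horner_poly mulr_sumr.
apply: eq_bigr => j _; rewrite Qc sin_coef_closed // !exprMn; ring.
Qed.

Lemma struve_poly_alternates (R : realType) (mu : R) n m :
    0 <= mu <= 1 -> (0 < m <= n)%N ->
  (-1) ^+ m * (struve_poly mu n).[n%:R * n.+1%:R * (2 - 2 * cos (node R n m))] < 0.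
Proof.
move=> /andP[mu0 mu1] mn; have n0 : (0 < n)%N by case/andP: mn => /leq_trans; apply.
have /andP[t0 tpi] := node_itv R mn.
have s0 : 0 < sin (node R n m) by rewrite sin_gt0_pi // t0.
rewrite -(pmulr_rlt0 _ (sin_coef0_gt0 mu0 n0)) mulrCA -struve_poly_sin_poly //.
rewrite -(pmulr_rlt0 _ s0) mulrCA.
rewrite horner_sum mulr_sumr (eq_bigr (fun k : 'I_n.+1 =>
    struve_weight mu n k * sin (k%:R * node R n m))); last first.
  by move=> k _; rewrite hornerZ mulrCA sin_poly_horner.
apply: sum_sin_alternates => //; first exact: struve_weight_ge0.
  by move=> k; apply: struve_weight_le; rewrite mu0.
exact: struve_weight_strict.
Qed.

Lemma struve_poly_derivX_prod (R : realType) (mu : R) n : 0 <= mu <= 1 ->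
  exists2 s : seq R, (forall y, y \in s -> 0 < y) &
    ('X * struve_poly mu n.+1)^`() = \prod_(y <- s) (1 - y^-1 *: 'X).
Proof.
move=> mu01.
apply: (@alternating_derivX_prod _ _ n
  (fun m => n.+1%:R * n.+2%:R * (2 - 2 * cos (node R n.+1 m.+1)))).
- exact: size_poly.
- rewrite horner_coef0 coef_poly /= expr0 mul1r /struve_coef /approx_factor.
  by rewrite !big_ord0 mulr1.
- rewrite mulr_gt0 ?mulr_gt0 // subr_gt0 -[ltRHS]mulr1 ltr_pM2l // cos_lt1 //.
  exact: node_itv.
- move=> m mn; rewrite ltr_pM2l ?mulr_gt0 // ltrD2l ltrN2 ltr_pM2l //.
  have h1 := @node_itv R n.+1 m.+1 ltac:(lia).
  have h2 := @node_itv R n.+1 m.+2 ltac:(lia).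
  case/andP: h1 => a1 b1; case/andP: h2 => a2 b2.
  rewrite ltr_cos ?in_itv /= ?(ltW a1) ?(ltW a2) ?(ltW b1) ?(ltW b2) //.
  exact: node_lt.
- move=> m mn; have := @struve_poly_alternates R mu n.+1 m.+1 mu01 ltac:(lia).
  by rewrite exprS mulN1r mulNr oppr_lt0.
Qed.

(** * Products with positive zeros *)

(** The logarithmic derivative of the product is
[- \sum_y (y - z)^-1], and [y - r] is the smallest modulus of [y - z] over the
disc; the statement is kept free of divisions in order to survive limits. *)
Lemma prod_pos_roots_bound (K : numFieldType) (s : seq K) (r z : K) :
    0 <= r -> `|z| <= r -> (forall y, y \in s -> r < y) ->
    let q := \prod_(y <- s) (1 - y^-1 *: 'X) in
  [/\ 0 < q.[r], q.[r] <= `|q.[z]| &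
      `|z * q^`().[z]| * q.[r] <= - (r * q^`().[r]) * `|q.[z]|].
Proof.
move=> r0 zr; elim: s => [|y s IH] ys /=.
  by rewrite big_nil -polyC1 derivC !hornerC !mulr0 normr0 normr1 oppr0 !mul0r lexx ltr01.
rewrite big_cons; set p := \prod_(y <- s) _ in IH *.
have [p0 pz pd] := IH (fun x xs => ys x (@mem_behead _ (y :: s) _ xs)).
have ry := ys y (mem_head _ _); have y0 : 0 < y by exact: le_lt_trans ry.
have yN0 : y != 0 by rewrite gt_eqF.
have Ez x : ((1 - y^-1 *: 'X) * p).[x] = (1 - x / y) * p.[x].
  by rewrite hornerM !hornerE [x / y]mulrC.
have Ed x : ((1 - y^-1 *: 'X) * p)^`().[x] =
    - (p.[x] / y) + (1 - x / y) * p^`().[x].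
  by rewrite derivM !hornerE derivB derivC derivZ derivX !hornerE; ring.
have a0 : 0 < 1 - r / y by rewrite subr_gt0 ltr_pdivrMr ?mul1r.
have az : 1 - r / y <= `|1 - z / y|.
  apply: le_trans (lerB_dist _ _); rewrite normr1 lerD2l lerN2 normrM normfV.
  by rewrite (gtr0_norm y0) ler_pM2r ?invr_gt0.
rewrite !Ez !Ed; split; first exact: mulr_gt0.
  by rewrite normrM; apply: ler_pM => //; exact: ltW.
set a := 1 - r / y in a0 az *; set b := `|1 - z / y| in az *.
have b0 : 0 <= b by exact: normr_ge0.
have yi0 : 0 <= y^-1 by rewrite invr_ge0 ltW.
have Y : 0 <= r / y by rewrite mulr_ge0.
apply: (@le_trans _ _ ((r / y * `|p.[z]| + b * `|z * p^`().[z]|) * (a * p.[r]))).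
  apply: ler_wpM2r; first by rewrite ltW // mulr_gt0.
  have -> : z * (- (p.[z] / y) + (1 - z / y) * p^`().[z]) =
    - (z / y * p.[z]) + (1 - z / y) * (z * p^`().[z]) by ring.
  apply: le_trans (ler_normD _ _) _; rewrite normrN !normrM -/b lerD //.
  by rewrite normfV (gtr0_norm y0) !ler_wpM2r.
have -> : - (r * (- (p.[r] / y) + a * p^`().[r])) * `|(1 - z / y) * p.[z]| =
    r / y * `|p.[z]| * p.[r] * b + a * b * (- (r * p^`().[r]) * `|p.[z]|).
  by rewrite normrM -/b; ring.
have -> : (r / y * `|p.[z]| + b * `|z * p^`().[z]|) * (a * p.[r]) =
    r / y * `|p.[z]| * p.[r] * a + a * b * (`|z * p^`().[z]| * p.[r]) by ring.
apply: lerD; first by rewrite ler_wpM2l ?mulr_ge0 // ltW.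
by rewrite ler_wpM2l // mulr_ge0 // ltW.
Qed.

(** * Entire functions with real coefficients *)

Definition cmod (R : realType) (z : Cx R) : R := complex.Re `|z|.

Lemma cmodE (R : realType) (z : Cx R) : `|z| = (cmod z)%:C.
Proof. by case: z. Qed.

Lemma cmod_ge0 (R : realType) (z : Cx R) : 0 <= cmod z.
Proof. by have := normr_ge0 z; rewrite cmodE; rewrite (lecR 0 (cmod z)). Qed.

Lemma cmod_real (R : realType) (x : R) : cmod (x%:C : Cx R) = `|x|.
Proof. by rewrite /cmod normc_def /= expr0n addr0 sqrtr_sqr. Qed.

Lemma normC_real (R : realType) (x : R) : `|(x%:C : Cx R)| = `|x|%:C.
Proof. by rewrite cmodE cmod_real. Qed.

(** Completeness of the reals is enough for complex series: the real and the
imaginary parts converge separately. *)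
Lemma cvg_complex (R : realType) (u v : nat -> R) (a b : R) :
  (u @ \oo --> a)%classic -> (v @ \oo --> b)%classic ->
  ((fun n => (u n +i* v n : Cx R)) @ \oo --> (a +i* b : Cx R))%classic.
Proof.
move=> /cvgrPdist_lt ua /cvgrPdist_lt vb; apply/cvgrPdist_lt => e.
rewrite ltcE /= => /andP[/eqP e1 e0].
have eE : e = (complex.Re e)%:C by case: e e1 {e0} => er ei /= ->.
have e2 : 0 < complex.Re e / 2 by rewrite divr_gt0.
apply: filterS2 (ua _ e2) (vb _ e2) => n an bn.
rewrite eE.
have -> : (a +i* b : Cx R) - (u n +i* v n) =
    (a - u n)%:C + (0 +i* 1) * (b - v n)%:C.
  by apply/eqP; rewrite eq_complex /=; apply/andP; split; apply/eqP; ring.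
apply: le_lt_trans (ler_normD _ _) _; rewrite normrM !normC_real.
have -> : `|(0 +i* 1 : Cx R)| = 1.
  by rewrite normc_def /= expr0n add0r expr1n sqrtr1.
by rewrite mul1r -rmorphD /= ltcR [ltRHS]splitr ltrD.
Qed.

Lemma cvg_norm_le (K : numFieldType) (u : nat -> K) (l M : K) :
  (u @ \oo --> l)%classic -> (forall n, `|u n| <= M) -> `|l| <= M.
Proof.
move=> ul uM; apply/ler_addgt0Pr => e e0.
have /cvgrPdist_lt /(_ e e0) [N _ /(_ N (leqnn _)) h] := ul.
rewrite -(subrK (u N) l) addrC; apply: le_trans (ler_normD _ _) _.
by rewrite lerD // ltW.
Qed.

(** Serves both for real and for complex derivatives. *)
Lemma norm_quadratic_is_derive (K : numFieldType) (f : K -> K) (z l M : K) :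
    (forall h, `|h| <= 1 -> `|f (z + h) - f z - h * l| <= `|h| ^+ 2 * M) ->
  is_derive z 1 f l.
Proof.
move=> H.
have M0 : 0 <= M.
  by have := H 1; rewrite normr1 expr1n !mul1r => /(_ (lexx _)); exact: le_trans.
have C : ((fun h => h^-1 *: ((f \o shift z) (h *: 1) - f z)) @ 0^' --> l)%classic.
  apply/cvgrPdist_lt => e e0; have d0 : 0 < e / (M + 1) by rewrite divr_gt0 ?ltr_wpDl.
  near=> h.
  have hN0 : h != 0 by near: h; exact: nbhs_dnbhs_neq.
  have h1 : `|h| < 1.
    by near: h; apply: dnbhs0_lt.
  have hd : `|h| < e / (M + 1).
    by near: h; apply: dnbhs0_lt.
  rewrite /= -[h *: 1]/(h * 1) mulr1 [h + z]addrC -normrN opprB.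
  rewrite -(ltr_pM2l (_ : 0 < `|h|)) ?normr_gt0 // -normrM mulrBr.
  rewrite -[h^-1 *: _]/(h^-1 * _) mulVKf //; apply: le_lt_trans (H _ (ltW h1)) _.
  rewrite expr2 -mulrA ltr_pM2l ?normr_gt0 //; apply: (@le_lt_trans _ _ (`|h| * (M + 1))).
    by rewrite ler_wpM2l // lerDl.
  by rewrite -ltr_pdivlMr ?ltr_wpDl.
split; first by apply/cvg_ex; exists l.
by apply/cvg_lim.
Unshelve. all: by end_near.
Qed.

(** Second-order Taylor remainder of a monomial; it iterates
[e (j + 1) = (z + h) * e j + j * h ^ 2 * z ^ (j - 1)]. *)
Lemma monomial_taylor (K : numFieldType) (z h rho : K) j :
    1 <= rho -> `|z| + `|h| <= rho ->
  `|(z + h) ^+ j - z ^+ j - h * (j%:R * z ^+ j.-1)| <= `|h| ^+ 2 * (j%:R ^+ 2 * rho ^+ j).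
Proof.
move=> r1 zh; have r0 : 0 <= rho by exact: le_trans r1.
have zr : `|z| <= rho by apply: le_trans zh; rewrite lerDl.
elim: j => [|j IH].
  by rewrite !expr0 subrr mul0r mulr0 subrr normr0 expr0n /= mul0r mulr0.
have E : (z + h) ^+ j.+1 - z ^+ j.+1 - h * (j.+1%:R * z ^+ j) =
    (z + h) * ((z + h) ^+ j - z ^+ j - h * (j%:R * z ^+ j.-1)) +
    h ^+ 2 * (j%:R * z ^+ j.-1).
  case: j {IH} => [|j]; first by rewrite !expr1 !expr0; ring.
  by rewrite -pred_Sn !exprS -!natr1; ring.
rewrite E; apply: le_trans (ler_normD _ _) _.
apply: (@le_trans _ _ (rho * (`|h| ^+ 2 * (j%:R ^+ 2 * rho ^+ j)) +
    `|h| ^+ 2 * (j%:R * rho ^+ j.+1))).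
  apply: lerD; rewrite normrM.
    by apply: ler_pM => //; apply: le_trans zh; exact: ler_normD.
  rewrite normrX ler_wpM2l ?exprn_ge0 // normrM normr_nat ler_wpM2l //.
  rewrite normrX; apply: (@le_trans _ _ (rho ^+ j.-1)); first exact: lerXn2r.
  by apply: ler_weXn2l => //; lia.
have -> : rho * (`|h| ^+ 2 * (j%:R ^+ 2 * rho ^+ j)) + `|h| ^+ 2 * (j%:R * rho ^+ j.+1)
   = `|h| ^+ 2 * ((j%:R ^+ 2 + j%:R) * rho ^+ j.+1) by rewrite (exprS rho); ring.
rewrite ler_wpM2l ?exprn_ge0 // ler_wpM2r ?exprn_ge0 //.
by rewrite -!natrX -natrD ler_nat; nia.
Qed.

(** Equivalent to an infinite radius of convergence, since the radius is arbitrary. *)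
Definition entire (R : realType) (c : nat -> R) : Prop :=
  forall rho, 0 <= rho -> exists M, forall j, `|c j| * rho ^+ j <= M.

Definition abs_sum (R : realType) (c : nat -> R) (rho : R) : R :=
  limn (series (fun j => `|c j| * rho ^+ j)).

Definition cterm (R : realType) (c : nat -> R) (z : Cx R) (j : nat) : Cx R :=
  (c j)%:C * z ^+ j.

Definition csum (R : realType) (c : nat -> R) (z : Cx R) : Cx R :=
  limn (series (cterm c z)).

Definition dcoef (R : realType) (c : nat -> R) (j : nat) : R := j.+1%:R * c j.+1.

Lemma entire_le (R : realType) (c d : nat -> R) :
  entire c -> (forall j, `|d j| <= `|c j|) -> entire d.
Proof.
move=> ec cd rho r0; have [M HM] := ec rho r0; exists M => j.
by apply: le_trans (HM j); rewrite ler_wpM2r // exprn_ge0.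
Qed.

Lemma entire_nat (R : realType) (c : nat -> R) :
  entire c -> entire (fun j => j.+1%:R * c j).
Proof.
move=> ec rho r0; have [|M HM] := ec (2 * rho); first by rewrite mulr_ge0.
exists M => j; apply: le_trans (HM j); rewrite normrM normr_nat exprMn mulrA.
rewrite ler_wpM2r ?exprn_ge0 // mulrC ler_wpM2l // -natrX ler_nat.
exact: ltn_expl.
Qed.

Lemma entire_nat2 (R : realType) (c : nat -> R) :
  entire c -> entire (fun j => j%:R ^+ 2 * c j).
Proof.
move=> /entire_nat /entire_nat ec; apply: entire_le ec _ => j.
rewrite mulrA -natrM -natrX !normrM !normr_nat ler_wpM2r // ler_nat; nia.
Qed.

Lemma entire_dcoef (R : realType) (c : nat -> R) : entire c -> entire (dcoef c).
Proof.
move=> ec rho r0.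
have [|M HM] := ec (2 * (rho + 1)); first by rewrite mulr_ge0 ?addr_ge0.
exists M => j; apply: le_trans (HM j.+1); rewrite /dcoef normrM normr_nat.
rewrite [_ * `|_|]mulrC -mulrA ler_wpM2l // exprMn.
rewrite ler_pM ?exprn_ge0 //.
  by rewrite -natrX ler_nat ltnW // ltn_expl.
apply: (@le_trans _ _ ((rho + 1) ^+ j)); first by apply: lerXn2r; rewrite ?nnegrE ?addr_ge0 // lerDl.
by apply: ler_weXn2l => //; rewrite lerDr.
Qed.

Lemma entire_shift (R : realType) (c : nat -> R) :
  entire c -> entire (fun j => if j is i.+1 then c i else 0).
Proof.
move=> ec rho r0; have [M HM] := ec rho r0.
have M0 : 0 <= M by apply: le_trans (HM 0%N); rewrite mulr_ge0 ?exprn_ge0.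
exists (rho * M) => -[|j]; first by rewrite normr0 mul0r mulr_ge0.
by rewrite exprS mulrCA ler_wpM2l.
Qed.

Lemma abs_sum_cvg (R : realType) (c : nat -> R) rho : entire c -> 0 <= rho ->
  cvgn (series (fun j => `|c j| * rho ^+ j)).
Proof.
move=> ec r0; have [|M HM] := ec (2 * rho); first by rewrite mulr_ge0.
have M0 : 0 <= M by apply: le_trans (HM 0%N); rewrite mulr_ge0 ?exprn_ge0 ?mulr_ge0.
apply: (@series_le_cvg _ _ (geometric M (1 / 2))) => [j|j|j|].
- by rewrite mulr_ge0 ?exprn_ge0.
- by rewrite mulr_ge0 ?exprn_ge0.
- rewrite /= -(ler_pM2r (_ : 0 < 2 ^+ j)) ?exprn_gt0 // -[leRHS]mulrA -exprMn.
  rewrite div1r mulVf // expr1n mulr1 -mulrA [rho ^+ j * _]mulrC -exprMn.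
  exact: HM.
- by apply: is_cvg_geometric_series; rewrite ger0_norm; lra.
Qed.

Lemma abs_sum_ge (R : realType) (c : nat -> R) rho N : entire c -> 0 <= rho ->
  \sum_(j < N) `|c j| * rho ^+ j <= abs_sum c rho.
Proof.
move=> ec r0; rewrite -(big_mkord xpredT (fun j => `|c j| * rho ^+ j)).
apply: (nondecreasing_cvgn_le (u_ := series _)) (abs_sum_cvg ec r0) N.
apply/nondecreasing_seqP => n; rewrite /series /= big_nat_recr //= lerDl.
by rewrite mulr_ge0 ?exprn_ge0.
Qed.

Lemma abs_sum_le (R : realType) (c : nat -> R) rho rho' : entire c ->
  0 <= rho -> rho <= rho' -> abs_sum c rho <= abs_sum c rho'.
Proof.
move=> ec r0 rr; have r0' := le_trans r0 rr.
apply: limr_le; first exact: abs_sum_cvg.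
near=> n; apply: le_trans (abs_sum_ge n ec r0').
rewrite /series /= big_mkord; apply: ler_sum => j _.
by rewrite ler_wpM2l // lerXn2r.
Unshelve. all: by end_near.
Qed.

Lemma seriesC (R : realType) (c : nat -> R) (z : Cx R) :
  series (cterm c z) =
  (fun n => (series (fun j => c j * complex.Re (z ^+ j)) n +i*
             series (fun j => c j * complex.Im (z ^+ j)) n : Cx R)).
Proof.
apply/funext => n; rewrite /series /=; elim: n => [|n IH].
  by rewrite !big_geq.
rewrite !big_nat_recr //= IH /cterm; case: (z ^+ n) => a b /=.
by apply/eqP; rewrite eq_complex /= !mul0r subr0 addr0 !eqxx.
Qed.

Lemma csum_cvg (R : realType) (c : nat -> R) (z : Cx R) : entire c ->
  (series (cterm c z) @ \oo --> csum c z)%classic.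
Proof.
move=> ec; have a0 := cmod_ge0 z.
have abs (g : Cx R -> R) : (forall w, `|g w| <= cmod w) ->
    cvgn (series (fun j => c j * g (z ^+ j))).
  move=> gle; apply: normed_cvg; apply: series_le_cvg (abs_sum_cvg ec a0) => j.
  - exact: normr_ge0.
  - by rewrite mulr_ge0 ?exprn_ge0.
  - rewrite /= normrM ler_wpM2l //; apply: le_trans (gle _) _.
    have : `|z ^+ j| = (cmod z ^+ j)%:C by rewrite normrX cmodE rmorphXn.
    by rewrite cmodE => /complexI ->.
have reP := abs (fun w : Cx R => complex.Re w).
have imP := abs (fun w : Cx R => complex.Im w).
have leRe w : `|complex.Re w| <= cmod w :> R.
  by rewrite -lecR -[X in _ <= X]cmodE normc_ge_Re.
have leIm w : `|complex.Im w| <= cmod w :> R.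
  rewrite /cmod normc_def /= -sqrtr_sqr ler_sqrt ?addr_ge0 ?sqr_ge0 //.
  by rewrite lerDr sqr_ge0.
have := cvg_complex (reP leRe) (imP leIm).
rewrite -seriesC /csum => H.
by rewrite (cvg_lim _ H).
Qed.
Arguments csum_cvg {R c} z _.

Lemma realCD (R : realType) (x y : R) : x%:C + y%:C = (x + y)%:C :> Cx R.
Proof. by rewrite -rmorphD. Qed.

Lemma realCB (R : realType) (x y : R) : x%:C - y%:C = (x - y)%:C :> Cx R.
Proof. by rewrite -rmorphB. Qed.

Lemma realCN (R : realType) (x : R) : - x%:C = (- x)%:C :> Cx R.
Proof. by rewrite -rmorphN. Qed.

Lemma realCM (R : realType) (x y : R) : x%:C * y%:C = (x * y)%:C :> Cx R.
Proof. by rewrite -rmorphM. Qed.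

Lemma realCX (R : realType) (x : R) n : x%:C ^+ n = (x ^+ n)%:C :> Cx R.
Proof. by rewrite -rmorphXn. Qed.

Lemma realC_le (R : realType) (x y : R) : (x%:C <= y%:C :> Cx R) = (x <= y).
Proof. exact: lecR. Qed.

Lemma realC_lt (R : realType) (x y : R) : (x%:C < y%:C :> Cx R) = (x < y).
Proof. exact: ltcR. Qed.

(** Restriction of [csum] to the real line; real coefficients make it real
([csum_real]). *)
Definition rsum (R : realType) (c : nat -> R) (x : R) : R :=
  complex.Re (csum c x%:C).

Lemma csum_rsum_lim (R : realType) (c : nat -> R) (x : R) : entire c ->
  csum c x%:C = (limn (series (fun j => c j * x ^+ j)))%:C.
Proof.
move=> ec; have H := csum_cvg x%:C ec.
have rc : cvgn (series (fun j => c j * x ^+ j)).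
  apply: normed_cvg; apply: series_le_cvg (abs_sum_cvg ec (normr_ge0 x)) => j.
  - exact: normr_ge0.
  - by rewrite mulr_ge0 ?exprn_ge0.
  - by rewrite /= normrM normrX.
have v0 : ((fun=> 0 : R) @ \oo --> (0 : R))%classic by exact: cvg_cst.
have := cvg_complex rc v0.
have -> : (fun n => (series (fun j => c j * x ^+ j) n +i* 0 : Cx R)) =
    series (cterm c x%:C).
  apply/funext => n; rewrite /series /=; elim: n => [|n IH]; first by rewrite !big_geq.
  rewrite !big_nat_recr //= -IH /cterm -rmorphXn -rmorphM.
  by apply/eqP; rewrite eq_complex /= addr0 !eqxx.
by move=> H'; rewrite /csum (cvg_lim _ H').
Qed.

Lemma csum_real (R : realType) (c : nat -> R) (x : R) : entire c ->
  csum c x%:C = (rsum c x)%:C.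
Proof. by move=> ec; rewrite /rsum csum_rsum_lim. Qed.

Lemma rsumE (R : realType) (c : nat -> R) (x : R) : entire c ->
  rsum c x = limn (series (fun j => c j * x ^+ j)).
Proof. by move=> ec; rewrite /rsum csum_rsum_lim. Qed.

Lemma csum_cvgS (R : realType) (c : nat -> R) (z : Cx R) : entire c ->
  ((fun n => series (cterm c z) n.+1) @ \oo --> csum c z)%classic.
Proof. by move=> ec; rewrite (cvg_shiftS (series (cterm c z))); exact: csum_cvg. Qed.
Arguments csum_cvgS {R c} z _.

Lemma cvg_scaleC (R : realType) (u : nat -> Cx R) (l z : Cx R) :
  (u @ \oo --> l)%classic -> ((fun n => z * u n) @ \oo --> z * l)%classic.
Proof. exact: cvgMl_tmp. Qed.

Lemma csum_shift (R : realType) (c : nat -> R) (z : Cx R) : entire c ->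
  csum (fun j => if j is i.+1 then c i else 0) z = z * csum c z.
Proof.
move=> ec; have H := csum_cvgS z (entire_shift ec).
apply: (cvg_unique _ H); first exact: norm_hausdorff.
have -> : (fun n => series (cterm (fun j => if j is i.+1 then c i else 0) z) n.+1) =
    (fun n => z * series (cterm c z) n).
  apply/funext => n; rewrite /series /= big_nat_recl // mulr_sumr {1}/cterm mul0r add0r.
  by apply: eq_bigr => j _; rewrite /cterm exprS mulrCA.
exact: cvg_scaleC (csum_cvg z ec).
Qed.

Lemma csum0 (R : realType) (c : nat -> R) : entire c -> csum c (0 : Cx R) = (c 0)%:C.
Proof.
move=> ec; have H := csum_cvgS (0 : Cx R) ec.
apply: (cvg_unique _ H); first exact: norm_hausdorff.
have -> : (fun n => series (cterm c (0 : Cx R)) n.+1) = (fun=> (c 0)%:C).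
  apply/funext => n; rewrite /series /= big_nat_recl // big1 => [|j _].
    by rewrite /cterm mulr1 addr0.
  by rewrite /cterm exprS mul0r mulr0.
exact: cvg_cst.
Qed.

Lemma csum_norm_le (R : realType) (c e : nat -> R) (z l : Cx R) (u : nat -> Cx R) rho M :
    entire e -> 0 <= rho -> 0 <= M -> (u @ \oo --> l)%classic ->
    (forall n, `|u n| <= \sum_(j < n.+1) (M * (`|e j| * rho ^+ j))%:C) ->
  `|l| <= (M * abs_sum e rho)%:C.
Proof.
move=> ee r0 M0 ul H; apply: cvg_norm_le ul _ => n; apply: le_trans (H n) _.
by rewrite -rmorph_sum realC_le -mulr_sumr ler_wpM2l // abs_sum_ge.
Qed.

(** A quadratic remainder summed term by term yields the derivative without any
appeal to uniform convergence. *)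
Lemma csum_taylor (R : realType) (c : nat -> R) (z h : Cx R) : entire c ->
    `|h| <= 1 ->
  `|csum c (z + h) - csum c z - h * csum (dcoef c) z| <=
  `|h| ^+ 2 * (abs_sum (fun j => j%:R ^+ 2 * c j) (cmod z + 1))%:C.
Proof.
move=> ec h1; have r0 : 0 <= cmod z + 1 by rewrite addr_ge0 ?cmod_ge0.
have -> : `|h| ^+ 2 * (abs_sum (fun j => j%:R ^+ 2 * c j) (cmod z + 1))%:C =
  (cmod h ^+ 2 * abs_sum (fun j => j%:R ^+ 2 * c j) (cmod z + 1))%:C.
  by rewrite cmodE rmorphM rmorphXn.
apply: (@csum_norm_le _ c _ z _
  (fun n => series (cterm c (z + h)) n.+1 - series (cterm c z) n.+1
    - h * series (cterm (dcoef c) z) n) _ _ (entire_nat2 ec)) => //.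
- by rewrite exprn_ge0 // cmod_ge0.
- apply: cvgB; last exact: cvg_scaleC (csum_cvg z (entire_dcoef ec)).
  by apply: cvgB; exact: csum_cvgS.
move=> n; have -> : series (cterm c (z + h)) n.+1 - series (cterm c z) n.+1
    - h * series (cterm (dcoef c) z) n =
    \sum_(j < n.+1) (c j)%:C * ((z + h) ^+ j - z ^+ j - h * (j%:R * z ^+ j.-1)).
  rewrite /series /= !big_mkord -sumrB mulr_sumr [RHS]big_ord_recl.
  rewrite [X in X - _ = _]big_ord_recl /= {1 2}/cterm !expr0 !subrr add0r.
  rewrite mulr0n mul0r mulr0 subr0 mulr0 add0r.
  rewrite -sumrB; apply: eq_bigr => j _.
  by rewrite /cterm /dcoef /bump /= add1n rmorphM rmorph_nat; ring.
apply: le_trans (ler_norm_sum _ _ _) _; apply: ler_sum => j _.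
have -> : (cmod h ^+ 2 * (`|j%:R ^+ 2 * c j| * (cmod z + 1) ^+ j))%:C =
    `|c j|%:C * (`|h| ^+ 2 * (j%:R ^+ 2 * (cmod z + 1)%:C ^+ j)) :> Cx R.
  by rewrite normrM (ger0_norm (sqr_ge0 _)) cmodE !(rmorphM, rmorphXn) rmorph_nat; ring.
rewrite normrM normC_real ler_wpM2l ?(ler0c) //; apply: monomial_taylor.
  by rewrite (lecR 1 (cmod z + 1)) lerDr cmod_ge0.
by rewrite rmorphD /= -cmodE lerD2l.
Qed.

Lemma csum_is_derive (R : realType) (c : nat -> R) (z : Cx R) : entire c ->
  is_derive z 1 (csum c) (csum (dcoef c) z).
Proof.
by move=> ec; apply: norm_quadratic_is_derive => h; exact: csum_taylor.
Qed.

Lemma rsum_is_derive (R : realType) (c : nat -> R) (x : R) : entire c ->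
  is_derive x 1 (rsum c) (rsum (dcoef c) x).
Proof.
move=> ec; apply: (@norm_quadratic_is_derive _ _ _ _
  (abs_sum (fun j => j%:R ^+ 2 * c j) (cmod (x%:C : Cx R) + 1))) => h h1.
have := @csum_taylor R c x%:C h%:C ec; rewrite normC_real (lecR _ 1) => /(_ h1).
rewrite realCD !csum_real ?entire_dcoef //; last exact: entire_dcoef.
by rewrite realCM !realCB normC_real realCX realCM realC_le.
Qed.

Lemma rsum_continuous (R : realType) (c : nat -> R) : entire c ->
  continuous (rsum c).
Proof.
move=> ec x; apply: differentiable_continuous; apply/derivable1_diffP.
by have [] := rsum_is_derive x ec.
Qed.

Lemma rsum0 (R : realType) (c : nat -> R) : entire c -> rsum c 0 = c 0.
Proof. by move=> ec; rewrite /rsum csum0. Qed.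

Lemma rsum_shift (R : realType) (c : nat -> R) (x : R) : entire c ->
  rsum (fun j => if j is i.+1 then c i else 0) x = x * rsum c x.
Proof.
move=> ec; apply: complexI; rewrite -csum_real; last exact: entire_shift.
by rewrite csum_shift // csum_real // realCM.
Qed.

Definition coef_close (R : realType) (c e : nat -> R) (p : {poly R}) (eps : R) :=
  forall j, `|c j - p`_j| <= eps * `|e j|.

Lemma csum_poly_close (R : realType) (c e : nat -> R) (p : {poly R}) (z : Cx R) (eps : R) :
    entire c -> entire e -> 0 <= eps ->
    coef_close c e p eps ->
  `|csum c z - (map_poly (real_complex R) p).[z]| <= (eps * abs_sum e (cmod z))%:C.
Proof.
move=> ec ee eps0 H; set q := map_poly _ p.
have C : ((fun n => \sum_(j < maxn n.+1 (size p)) cterm c z j - q.[z])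
    @ \oo --> csum c z - q.[z])%classic.
  apply: cvgB; last exact: cvg_cst.
  have h := csum_cvgS z ec; apply: cvg_trans h; apply: near_eq_cvg.
  exists (size p) => // n /= pn; rewrite /series /= big_mkord.
  by rewrite (maxn_idPl _) // ltnW.
apply: cvg_norm_le C _ => n; set N := maxn _ _.
have szq : (size q <= N)%N.
  by rewrite size_map_poly leq_maxr.
rewrite (horner_coef_wide _ szq) -sumrB; apply: le_trans (ler_norm_sum _ _ _) _.
apply: (@le_trans _ _ (\sum_(j < N) (eps * (`|e j| * cmod z ^+ j))%:C)); last first.
  by rewrite -rmorph_sum realC_le -mulr_sumr ler_wpM2l // abs_sum_ge // cmod_ge0.
apply: ler_sum => j _; rewrite coef_map /= /cterm -mulrBl normrM normrX (cmodE z).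
rewrite realCB normC_real realCX realCM realC_le mulrA ler_wpM2r //.
by rewrite exprn_ge0 // cmod_ge0.
Qed.

Lemma csumE (R : realType) (c : nat -> R) (z : Cx R) :
  csum c z = limn (series (cterm c z)).
Proof. by []. Qed.

(* Keeps conversion from unfolding the limits. *)
Global Opaque csum rsum.

(** * Passage to the limit *)

(** Coefficients of [g], of [w = z g] and of [w']; the parameter [mu] stands for
[nu + 1/2]. *)
Definition g_coef (R : realType) (mu : R) (j : nat) : R :=
  (-1) ^+ j * struve_coef mu j.

Definition w_coef (R : realType) (mu : R) (j : nat) : R :=
  if j is i.+1 then g_coef mu i else 0.

Definition dw_coef (R : realType) (mu : R) := dcoef (w_coef mu).

Lemma struve_coef_gt0 (R : realType) (mu : R) j : 0 <= mu -> 0 < struve_coef mu j.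
Proof.
move=> mu0; apply: prodr_gt0 => i _; have i0 : 0 < i.+1%:R :> R by [].
by rewrite invr_gt0 !mulr_gt0 //; clear -mu0 i0; lra.
Qed.

Lemma g_coef_norm (R : realType) (mu : R) j : 0 <= mu ->
  `|g_coef mu j| = struve_coef mu j.
Proof.
move=> mu0; rewrite normrM normrX normrN1 expr1n mul1r ger0_norm //.
exact/ltW/struve_coef_gt0.
Qed.

Lemma struve_coef_le (R : realType) (mu : R) j : 0 <= mu ->
  struve_coef mu j <= (j`!%:R)^-1.
Proof.
move=> mu0; elim: j => [|j IH]; first by rewrite /struve_coef big_ord0 fact0 invr1.
rewrite /struve_coef big_ord_recr /= -/(struve_coef mu j) factS natrM [leRHS]invfM [leLHS]mulrC.
have j0 : 0 < j.+1%:R :> R by [].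
have j1 : 1 <= j.+1%:R :> R by rewrite ler1n.
have jm : 0 < 4 * (mu + j.+1%:R) * (j.+1%:R + 1 / 2).
  by move: (j.+1%:R : R) j0 {j1} => x x0; apply: mulr_gt0; lra.
apply: ler_pM => //; first by rewrite invr_ge0 ltW.
  exact/ltW/struve_coef_gt0.
rewrite lef_pV2 ?posrE //.
by move: (j.+1%:R : R) j0 j1 {jm} => x x0 x1; nra.
Qed.

Lemma entire_g_coef (R : realType) (mu : R) : 0 <= mu -> entire (g_coef mu).
Proof.
move=> mu0 rho r0; exists (expR rho) => j; rewrite g_coef_norm //.
apply: (@le_trans _ _ (exp_coeff rho j)).
  by rewrite /exp_coeff /= mulrC ler_wpM2l ?exprn_ge0 ?struve_coef_le.
have ge0 k : 0 <= exp_coeff rho k by rewrite /exp_coeff /= divr_ge0 ?exprn_ge0.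
apply: (@le_trans _ _ (series (exp_coeff rho) j.+1)).
  by rewrite /series /= big_nat_recr //= lerDr sumr_ge0.
apply: (nondecreasing_cvgn_le (u_ := series _)); last exact: is_cvg_series_exp_coeff.
by apply/nondecreasing_seqP => n; rewrite /series /= big_nat_recr //= lerDl.
Qed.

Lemma entire_w_coef (R : realType) (mu : R) : 0 <= mu -> entire (w_coef mu).
Proof. by move=> mu0; apply: entire_shift; exact: entire_g_coef. Qed.

Lemma entire_dw_coef (R : realType) (mu : R) : 0 <= mu -> entire (dw_coef mu).
Proof. by move=> mu0; apply: entire_dcoef; exact: entire_w_coef. Qed.

(** Factor number [i] is [1 - O ((i ^ 2 + 1) / n)] and lies in [[0, 1]], and a
product of such factors deviates from [1] by at most the sum of the deviations. *)
Lemma approx_factor_err (R : realType) (mu : R) n j : 0 <= mu <= 1 ->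
    (j < n)%N ->
  0 <= approx_factor mu n j <= 1 /\
  1 - approx_factor mu n j <= n%:R^-1 * j.+1%:R ^+ 3.
Proof.
move=> /andP[mu0 mu1]; elim: j => [|j IH] jn.
  rewrite /approx_factor big_ord0 subrr; split; first by rewrite ler01 lexx.
  by apply: mulr_ge0; rewrite ?invr_ge0 ?exprn_ge0.
have {IH} [/andP[a0 a1] a2] := IH (ltnW jn).
rewrite /approx_factor big_ord_recr /= -/(approx_factor mu n j).
set a := approx_factor _ _ _ in a0 a1 a2 *.
have h1 : j.+1%:R + 1 <= n%:R :> R by rewrite natr1 ler_nat.
have h2 : j.+2%:R = j.+1%:R + 1 :> R by rewrite natr1.
have h3 : 1 <= j.+1%:R :> R by rewrite ler1n.
have h4 : n.+1%:R = n%:R + 1 :> R by rewrite natr1.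
rewrite h2 h4; move: (j.+1%:R : R) (n%:R : R) a a0 a1 a2 h1 h3 => x y a a0 a1 a2 xy x1.
have y0 : 0 < y * (y + 1) by apply: mulr_gt0; lra.
set e := _ / _.
have e0 : 0 <= e by apply: divr_ge0; [apply: mulr_ge0; lra | exact: ltW].
have e1 : e <= 1 by rewrite ler_pdivrMr // mul1r; nra.
have e2 : 1 - e <= y^-1 * (1 + x ^+ 2).
  have -> : y^-1 * (1 + x ^+ 2) = (1 + x ^+ 2) * (y + 1) / (y * (y + 1)).
    by field; rewrite !gt_eqF //; lra.
  have -> : 1 - e = (y * (y + 1) - (y - x) * (y + x + mu)) / (y * (y + 1)).
    by rewrite /e; field; rewrite !gt_eqF //; lra.
  by rewrite ler_pM2r ?invr_gt0 //; nra.
split; first by rewrite mulr_ge0 //= mulr_ile1.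
have -> : 1 - a * e = (1 - a) + a * (1 - e) by ring.
apply: (@le_trans _ _ (y^-1 * x ^+ 3 + y^-1 * (1 + x ^+ 2))).
  apply: lerD => //; apply: le_trans e2; rewrite ler_piMl //.
  by rewrite subr_ge0.
rewrite -mulrDr ler_wpM2l //; first by rewrite invr_ge0; lra.
have -> : (x + 1) ^+ 3 = x ^+ 3 + (1 + 3 * x ^+ 2 + 3 * x) by ring.
by rewrite lerD2l; nra.
Qed.

Definition err_coef (R : realType) (mu : R) (j : nat) : R :=
  j.+1%:R * (j.+1%:R * (j.+1%:R * g_coef mu j)).

Lemma entire_err_coef (R : realType) (mu : R) : 0 <= mu -> entire (err_coef mu).
Proof. by move=> mu0; do 3!apply: entire_nat; exact: entire_g_coef. Qed.

(** Beyond the degree of the approximant the error bound exceeds the coefficient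
itself. *)
Lemma struve_poly_close (R : realType) (mu : R) n j : 0 <= mu <= 1 -> (0 < n)%N ->
  `|g_coef mu j - (struve_poly mu n)`_j| <= n%:R^-1 * `|err_coef mu j|.
Proof.
move=> mu01 n0; have /andP[mu0 mu1] := mu01.
have E : `|err_coef mu j| = j.+1%:R ^+ 3 * struve_coef mu j.
  by rewrite /err_coef normrM normr_nat normrM normr_nat normrM normr_nat g_coef_norm //; ring.
rewrite E coef_poly [leRHS]mulrA; have b0 := struve_coef_gt0 j mu0.
case: ltnP => jn; last first.
  rewrite subr0 g_coef_norm // -[leLHS]mul1r ler_pM2r // mulrC ler_pdivlMr ?ltr0n //.
  rewrite mul1r -natrX ler_nat; apply: leq_trans jn _; nia.
have [/andP[a0 a1] a2] := approx_factor_err mu01 jn.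
rewrite /g_coef -mulrBr normrM normrX normrN1 expr1n mul1r.
rewrite -[X in `|X - _|]mulr1 -mulrBr normrM (ger0_norm (ltW b0)) mulrC ler_pM2r //.
by rewrite ger0_norm // subr_ge0.
Qed.

Lemma coef_close_deriv (R : realType) (c e : nat -> R) (p : {poly R}) eps :
  coef_close c e p eps -> coef_close (dcoef c) (dcoef e) p^`() eps.
Proof.
move=> H j; rewrite /dcoef coef_deriv -[p`_ _ *+ _]mulr_natl -mulrBr !normrM normr_nat.
by rewrite mulrCA ler_wpM2l.
Qed.

Lemma coef_close_mulX (R : realType) (c e : nat -> R) (p : {poly R}) eps :
  coef_close c e p eps ->
  coef_close (fun j => if j is i.+1 then c i else 0)
    (fun j => if j is i.+1 then e i else 0) ('X * p) eps.
Proof.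
by move=> H [|j]; rewrite coefXM //= subrr !normr0 mulr0.
Qed.

Definition dw_poly (R : realType) (mu : R) (n : nat) : {poly R} :=
  ('X * struve_poly mu n.+1)^`().

Definition dw_err (R : realType) (mu : R) : nat -> R :=
  dcoef (fun j => if j is i.+1 then err_coef mu i else 0).

Lemma entire_dw_err (R : realType) (mu : R) : 0 <= mu -> entire (dw_err mu).
Proof. by move=> mu0; apply/entire_dcoef/entire_shift/entire_err_coef. Qed.

Lemma dw_poly_close (R : realType) (mu : R) n : 0 <= mu <= 1 ->
  coef_close (dw_coef mu) (dw_err mu) (dw_poly mu n) (n.+1%:R^-1).
Proof.
move=> mu01; apply/coef_close_deriv/coef_close_mulX => j.
exact: struve_poly_close.
Qed.

Lemma horner_map_real (R : realType) (p : {poly R}) (x : R) :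
  (map_poly (real_complex R) p).[x%:C] = (p.[x])%:C.
Proof. exact: horner_map. Qed.

Lemma real_prod_bound (R : realType) (q : {poly R}) (s : seq R) r (z : Cx R) :
    (forall y, y \in s -> 0 < y) -> q = \prod_(y <- s) (1 - y^-1 *: 'X) ->
    0 <= r -> cmod z <= r -> (forall x, 0 <= x <= r -> 0 < q.[x]) ->
    let Q := map_poly (real_complex R) q in
  q.[r] <= cmod Q.[z] /\
  cmod (z * Q^`().[z]) * q.[r] <= - (r * q^`().[r]) * cmod Q.[z].
Proof.
move=> s_gt0 qE r0 zr qpos Q.
have rs y : y \in s -> r < y.
  move=> ys; rewrite ltNge; apply/negP => yr.
  have := qpos y; rewrite yr (ltW (s_gt0 y ys)) => /(_ isT).
  have -> : q.[y] = 0; last by rewrite ltxx.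
  have y0 : y != 0 by rewrite gt_eqF ?s_gt0.
  by rewrite qE horner_prod (big_rem _ ys) /= !hornerE mulVf // subrr mul0r.
have QE : Q = \prod_(y <- map (real_complex R) s) (1 - y^-1 *: 'X).
  rewrite /Q qE rmorph_prod big_map; apply: eq_bigr => y _.
  by rewrite rmorphB rmorph1 /= map_polyZ map_polyX fmorphV.
have [||y|] := @prod_pos_roots_bound (Cx R) (map (real_complex R) s) r%:C z.
- by rewrite (realC_le 0).
- by rewrite cmodE realC_le.
- by move=> /mapP[x xs ->]; rewrite realC_lt rs.
rewrite -QE /= => _; rewrite deriv_map !horner_map_real -/Q !cmodE.
rewrite realC_le => h1; rewrite !realCM.
rewrite realCN realCM.
by rewrite realC_le.
Qed.

Lemma cvg_harmonic_mul (R : realType) (C : R) :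
  ((fun n : nat => n.+1%:R^-1 * C) @ \oo --> (0 : R))%classic.
Proof.
rewrite -[X in (_ --> X)%classic](mul0r C).
by apply: cvgMr_tmp; exact: cvg_harmonic.
Qed.

Lemma cvg_err (R : realType) (u : nat -> R) (l C : R) :
  (forall n, `|l - u n| <= n.+1%:R^-1 * C) -> (u @ \oo --> l)%classic.
Proof.
move=> H; have Z := cvg_harmonic_mul C.
apply: (@squeeze_cvgr _ _ _ _ (fun n => l - n.+1%:R^-1 * C) (fun n => l + n.+1%:R^-1 * C)).
- near=> n; have := H n; rewrite distrC ler_norml /=.
  move: (n.+1%:R^-1 * C) (u n) => a b /andP[h1 h2].
  by apply/andP; split; lra.
- by rewrite -[X in (_ --> X)%classic]subr0; apply: cvgB => //; exact: cvg_cst.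
- by rewrite -[X in (_ --> X)%classic]addr0; apply: cvgD => //; exact: cvg_cst.
Unshelve. all: by end_near.
Qed.

Lemma cmodM (R : realType) (z w : Cx R) : cmod (z * w) = cmod z * cmod w.
Proof. by apply: complexI; rewrite -cmodE normrM !cmodE rmorphM. Qed.

Lemma cmod_dist (R : realType) (z w : Cx R) : `|cmod z - cmod w| <= cmod (z - w).
Proof.
rewrite -realC_le -cmodE -normC_real -realCB -!cmodE.
by rewrite -[w in leLHS]opprK normrN; exact: ler_dist_normD.
Qed.

Lemma csum_poly_dist (R : realType) (c e : nat -> R) (p : {poly R}) (z : Cx R) eps :
    entire c -> entire e -> 0 <= eps -> coef_close c e p eps ->
  cmod (csum c z - (map_poly (real_complex R) p).[z]) <= eps * abs_sum e (cmod z).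
Proof.
move=> ec ee eps0 H; rewrite -realC_le -cmodE.
exact: csum_poly_close.
Qed.

Lemma rsum_poly_dist (R : realType) (c e : nat -> R) (p : {poly R}) (x : R) eps :
    entire c -> entire e -> 0 <= eps -> coef_close c e p eps ->
  `|rsum c x - p.[x]| <= eps * abs_sum e `|x|.
Proof.
move=> ec ee eps0 H; have := csum_poly_dist x%:C ec ee eps0 H.
by rewrite csum_real // horner_map_real realCB !cmod_real.
Qed.

Lemma rsum_ge_min (R : realType) (c : nat -> R) r : entire c -> 0 <= r ->
    (forall x, 0 <= x <= r -> 0 < rsum c x) ->
  exists2 m, 0 < m & forall x, 0 <= x <= r -> m <= rsum c x.
Proof.
move=> ec r0 pos.
have [|t] := @EVT_min _ (rsum c) _ _ r0.
  by apply: continuous_subspaceT => x; exact: rsum_continuous.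
rewrite in_itv /= => tr tmin; exists (rsum c t); first exact: pos.
by move=> x xr; apply: tmin; rewrite in_itv.
Qed.

Lemma near_err_lt (R : realType) (C m : R) : 0 < m ->
  (\forall n \near \oo%classic, n.+1%:R^-1 * C < m)%classic.
Proof.
move=> m0; have Z := cvg_harmonic_mul C.
exact: (cvgr_lt _ Z m m0).
Qed.

(** Eventually the uniform error is smaller than the positive minimum of the limit
on the compact interval. *)
Lemma near_poly_pos (R : realType) (c e : nat -> R) (p : nat -> {poly R}) r :
    entire c -> entire e -> (forall n, coef_close c e (p n) n.+1%:R^-1) ->
    0 <= r -> (forall x, 0 <= x <= r -> 0 < rsum c x) ->
  (\forall n \near \oo%classic, forall x, 0 <= x <= r -> 0 < (p n).[x])%classic.
Proof.
move=> ec ee H r0 pos; have [m m0 mle] := rsum_ge_min ec r0 pos.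
apply: filterS (near_err_lt (abs_sum e r) m0) => n nm x xr.
have /andP[x0 xr'] := xr.
have n0 : 0 <= n.+1%:R^-1 :> R by rewrite invr_ge0.
have := rsum_poly_dist x ec ee n0 (H n).
rewrite (ger0_norm x0) => h.
have h2 : n.+1%:R^-1 * abs_sum e x <= n.+1%:R^-1 * abs_sum e r.
  by rewrite ler_wpM2l // abs_sum_le.
have h3 := le_lt_trans (ler_norm _) (le_lt_trans (le_trans h h2) nm).
have h4 := mle x xr; rewrite ltrBlDr in h3.
by rewrite -(ltrD2l m) addr0 (le_lt_trans h4).
Qed.

(** The bounds for products of linear factors survive because both sides are
limits of their values at the approximants. *)
Lemma csum_bound (R : realType) (c e : nat -> R) (p : nat -> {poly R}) r (z : Cx R) :
    entire c -> entire e -> (forall n, coef_close c e (p n) n.+1%:R^-1) ->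
    (forall n, exists2 s : seq R, (forall y, y \in s -> 0 < y) &
       p n = \prod_(y <- s) (1 - y^-1 *: 'X)) ->
    cmod z <= r -> (forall x, 0 <= x <= r -> 0 < rsum c x) ->
  rsum c r <= cmod (csum c z) /\
  cmod (z * csum (dcoef c) z) * rsum c r <=
    - (r * rsum (dcoef c) r) * cmod (csum c z).
Proof.
move=> ec ee H prodp zr pos; have r0 := le_trans (cmod_ge0 z) zr.
have ppos := near_poly_pos ec ee H r0 pos.
have n0 n : 0 <= n.+1%:R^-1 :> R by rewrite invr_ge0.
have ec' := entire_dcoef ec; have ee' := entire_dcoef ee.
have cr : ((fun n => (p n).[r]) @ \oo --> rsum c r)%classic.
  by apply: cvg_err => n; exact: (rsum_poly_dist r ec ee (n0 n) (H n)).
have cr' : ((fun n => (p n)^`().[r]) @ \oo --> rsum (dcoef c) r)%classic.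
  by apply: cvg_err => n; exact: (rsum_poly_dist r ec' ee' (n0 n) (coef_close_deriv (H n))).
pose P n := map_poly (real_complex R) (p n).
have cz : ((fun n => cmod (P n).[z]) @ \oo --> cmod (csum c z))%classic.
  apply: cvg_err => n; apply: le_trans (cmod_dist _ _) _.
  exact: (csum_poly_dist z ec ee (n0 n) (H n)).
have cz' : ((fun n => cmod (z * (P n)^`().[z])) @ \oo -->
    cmod (z * csum (dcoef c) z))%classic.
  apply: (@cvg_err _ _ _ (cmod z * abs_sum (dcoef e) (cmod z))) => n.
  apply: le_trans (cmod_dist _ _) _.
  rewrite -mulrBr cmodM mulrCA ler_wpM2l ?cmod_ge0 // /P deriv_map.
  exact: (csum_poly_dist z ec' ee' (n0 n) (coef_close_deriv (H n))).
split.
  apply: (ler_cvg_to cr cz); apply: filterS ppos => n pn.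
  have [s s0 sE] := prodp n.
  by have [] := real_prod_bound s0 sE r0 zr pn.
apply: (ler_cvg_to (cvgM cz' cr) (cvgM (cvgN (cvgMl_tmp cr')) cz)).
apply: filterS ppos => n pn; have [s s0 sE] := prodp n.
by have [] := real_prod_bound s0 sE r0 zr pn.
Qed.

(** * First zeros *)

Lemma struve_bound (R : realType) (mu : R) r (z : Cx R) : 0 <= mu <= 1 ->
    cmod z <= r -> (forall x, 0 <= x <= r -> 0 < rsum (dw_coef mu) x) ->
  rsum (dw_coef mu) r <= cmod (csum (dw_coef mu) z) /\
  cmod (z * csum (dcoef (dw_coef mu)) z) * rsum (dw_coef mu) r <=
    - (r * rsum (dcoef (dw_coef mu)) r) * cmod (csum (dw_coef mu) z).
Proof.
move=> mu01; have /andP[mu0 _] := mu01.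
apply: csum_bound (entire_dw_coef mu0) (entire_dw_err mu0) _ _ => n.
  exact: dw_poly_close.
exact: struve_poly_derivX_prod.
Qed.

Lemma sin_le_id (R : realType) (t : R) : 0 <= t -> sin t <= t.
Proof.
rewrite le_eqVlt => /predU1P[<-|t0]; first by rewrite sin0.
have [|c _] := @MVT R sin cos 0 t t0 (fun x _ => is_derive_sin x).
  by apply: continuous_subspaceT => x; exact: continuous_sin.
by rewrite sin0 !subr0 => ->; rewrite ler_piMl ?cos_le1 // ltW.
Qed.

Lemma one_minus_cos_le (R : realType) (t : R) : 0 <= t -> 1 - cos t <= t ^+ 2.
Proof.
rewrite le_eqVlt => /predU1P[<-|t0]; first by rewrite cos0 subrr expr0n.
have [|c] := @MVT R cos (fun x => - sin x) 0 t t0 (fun x _ => is_derive_cos x).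
  by apply: continuous_subspaceT => x; exact: continuous_cos.
rewrite in_itv /= cos0 subr0 => /andP[c0 ct] E.
have -> : 1 - cos t = sin c * t by lra.
rewrite expr2 ler_pM2r //; apply: le_trans (ltW ct).
by apply: sin_le_id; exact: ltW.
Qed.

(** The approximants are negative at the second node, which after rescaling stays in
a fixed bounded interval. *)
Lemma g_sum_le0 (R : realType) (mu : R) : 0 <= mu <= 1 ->
  exists2 x, 0 < x & rsum (g_coef mu) x <= 0.
Proof.
move=> mu01; have /andP[mu0 _] := mu01; have p0 := pi_gt0 R.
(* n (n + 1) (2 - 2 cos t) <= 2 n (n + 1) t ^ 2 <= 8 pi ^ 2 at t = 4 pi / (2 n + 1) *)
pose B : R := 8 * pi ^+ 2.
apply: contrapT => H.
have pos x : 0 <= x <= B -> 0 < rsum (g_coef mu) x.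
  move=> /andP[]; rewrite le_eqVlt => /predU1P[<- _|x0 _].
    rewrite rsum0; last exact: entire_g_coef.
    by rewrite /g_coef /struve_coef big_ord0 mul1r.
  by rewrite ltNge; apply/negP => h; apply: H; exists x.
have B0 : 0 <= B by rewrite mulr_ge0 // sqr_ge0.
have := @near_poly_pos R (g_coef mu) (err_coef mu) (fun n => struve_poly mu n.+1) B
  (entire_g_coef mu0) (entire_err_coef mu0) _ B0 pos.
case=> [n j|N _ HN]; first exact: struve_poly_close.
have {HN} := HN N.+1 (leqnSn N).
set n := N.+2; have n2 : (0 < 2 <= n)%N by [].
have := struve_poly_alternates mu01 n2.
rewrite sqrrN expr1n mul1r; set x := _ * _ => xneg /(_ x).
have /andP[t0 _] := node_itv R n2.
suff xI : 0 <= x <= B by rewrite xI => /(_ isT); rewrite ltNge ltW.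
have := one_minus_cos_le (ltW t0); have := cos_le1 (node R n 2).
have n0 : 0 < n%:R :> R by [].
have nS : n.+1%:R = n%:R + 1 :> R by rewrite natr1.
have nD : n.*2.+1%:R = 2 * n%:R + 1 :> R by rewrite -natr1 -mul2n natrM.
rewrite /x /B nS; have tE : node R n 2 * (2 * n%:R + 1) = 4 * pi.
  by rewrite /node nD divfK; [ring | rewrite gt_eqF //; lra].
move: (node R n 2) (n%:R : R) t0 n0 tE => t y t0 y0 tE c1 c2.
have yy : 0 <= y * (y + 1) by apply: mulr_ge0; lra.
apply/andP; split; first by apply: mulr_ge0 => //; lra.
apply: (@le_trans _ _ (y * (y + 1) * (2 * t ^+ 2))); first by apply: ler_wpM2l => //; lra.
have : (t * (2 * y + 1)) ^+ 2 = 16 * pi ^+ 2 by rewrite tE; ring.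
have := sqr_ge0 t; nra.
Qed.

Lemma first_zero (R : realType) (f : R -> R) x : continuous f -> 0 < f 0 ->
    0 < x -> f x <= 0 ->
  exists2 s, 0 < s <= x /\ f s = 0 & forall t, 0 <= t < s -> 0 < f t.
Proof.
move=> cf f0 x0 fx.
pose A := [set t | 0 <= t /\ f t <= 0]%classic.
have Ax : A x by split => //; exact: ltW.
have A0 : lbound A 0 by move=> t [].
have iA : has_inf A by split; [exists x | exists 0].
pose s := inf A.
have s0 : 0 <= s by apply: lb_le_inf; [exists x | exact: A0].
have sA t : A t -> s <= t by move=> At; apply: ge_inf => //; exists 0.
have fpos t : 0 <= t < s -> 0 < f t.
  move=> /andP[t0 ts]; rewrite ltNge; apply/negP => ft.
  by have := sA t (conj t0 ft); rewrite leNgt ts.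
have fs : f s <= 0.
  rewrite leNgt; apply/negP => fs.
  have : (\forall t \near s, 0 < f t)%classic by exact: cvgr_gt (cf s) 0 fs.
  move=> /nbhs_ballP[e /= e0 He].
  have [a Aa sa] := inf_adherent e0 iA.
  have := He a; rewrite /ball /= => /(_ _) h.
  have : 0 < f a.
    by apply: h; rewrite distrC ger0_norm ?subr_ge0 ?sA // ltrBlDl.
  by case: Aa => _; rewrite leNgt => /negP.
have sp : 0 < s.
  rewrite lt_neqAle s0 andbT; apply/eqP => E; move: fs.
  by rewrite -E leNgt f0.
exists s => //; rewrite sp sA //; split => //.
apply/eqP; rewrite eq_le fs /= leNgt; apply/negP => fsn.
have : (\forall t \near s, f t < 0)%classic by exact: cvgr_lt (cf s) 0 fsn.
move=> /nbhs_ballP[e /= e0 He].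
pose t := Num.max 0 (s - e / 2).
have t0 : 0 <= t by rewrite /t le_max lexx.
have ts : t < s by rewrite /t gt_max sp; lra.
have : f t < 0.
  apply: He; rewrite /ball /= ger0_norm ?subr_ge0 ?ltW //.
  have : s - e / 2 <= t by rewrite /t le_max lexx orbT.
  by lra.
by rewrite ltNge ltW // fpos // t0.
Qed.

Lemma dw_sum0 (R : realType) (mu : R) : 0 <= mu -> rsum (dw_coef mu) 0 = 1.
Proof.
move=> mu0; rewrite rsum0; last exact: entire_dw_coef.
by rewrite /dw_coef /dcoef /= /g_coef /struve_coef big_ord0 !mul1r.
Qed.

Lemma w_sum (R : realType) (mu x : R) : 0 <= mu ->
  rsum (w_coef mu) x = x * rsum (g_coef mu) x.
Proof. by move=> mu0; apply: rsum_shift; exact: entire_g_coef. Qed.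

Lemma rsum_rolle (R : realType) (c : nat -> R) a b : entire c -> a < b ->
  rsum c a = rsum c b -> exists2 x, a < x < b & rsum (dcoef c) x = 0.
Proof.
move=> ec ab E; have [| |x] := @Rolle R (rsum c) a b ab _ _ E.
- by move=> x _; have [] := rsum_is_derive x ec.
- by apply: continuous_subspaceT => x; exact: rsum_continuous.
move=> xI D; exists x; first by move: xI; rewrite in_itv.
have [_ E1] := rsum_is_derive x ec; have [_ E2] := D.
by rewrite -E1 E2.
Qed.

(** Rolle's theorem for [x g x] between the origin and the first zero of [g]. *)
Lemma struve_zeros (R : realType) (mu : R) : 0 <= mu <= 1 ->
  exists h sigma, [/\ 0 < sigma < h,
    rsum (g_coef mu) h = 0, (forall t, 0 <= t < h -> 0 < rsum (g_coef mu) t),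
    rsum (dw_coef mu) sigma = 0 &
    (forall t, 0 <= t < sigma -> 0 < rsum (dw_coef mu) t)].
Proof.
move=> mu01; have /andP[mu0 _] := mu01; have eg := entire_g_coef mu0.
have [x x0 gx] := g_sum_le0 mu01.
have g0 : 0 < rsum (g_coef mu) 0.
  by rewrite rsum0 // /g_coef /struve_coef big_ord0 mul1r.
have [h [/andP[h0 _] gh] gpos] := first_zero (rsum_continuous eg) g0 x0 gx.
have ew := entire_w_coef mu0.
have W : rsum (w_coef mu) 0 = rsum (w_coef mu) h by rewrite !(w_sum _ mu0) gh mul0r mulr0.
have [y /andP[y0 yh] fy] := rsum_rolle ew h0 W.
have ef := entire_dw_coef mu0.
have f0 : 0 < rsum (dw_coef mu) 0 by rewrite dw_sum0.
have fy' : rsum (dw_coef mu) y <= 0 by rewrite /dw_coef fy.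
have [s [/andP[s0 sy] fs] fpos] := first_zero (rsum_continuous ef) f0 y0 fy'.
exists h, s; split; [|exact: gh|exact: gpos|exact: fs|exact: fpos].
by rewrite s0 (le_lt_trans sy).
Qed.

(** [x f] vanishes at both ends of the interval up to the first zero of [f], hence
[f + x f'] has a zero between them, where [q f + x f' <= 0] as [q <= 1]. *)
Lemma quotient_root (R : realType) (c : nat -> R) q sigma : entire c ->
    0 < q <= 1 -> 0 < sigma -> rsum c sigma = 0 ->
    (forall t, 0 <= t < sigma -> 0 < rsum c t) ->
  exists2 r, 0 < r < sigma /\ q * rsum c r + r * rsum (dcoef c) r = 0 &
    forall t, 0 <= t < r -> 0 < q * rsum c t + t * rsum (dcoef c) t.
Proof.
move=> ec /andP[q0 q1] s0 cs cpos; have ec' := entire_dcoef ec.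
have es := entire_shift ec.
have [|x /andP[x0 xs] dx] := rsum_rolle es s0; first by rewrite !(rsum_shift _ ec) cs mul0r mulr0.
have {}dx : rsum c x + x * rsum (dcoef c) x = 0.
  have D1 := rsum_is_derive x es.
  have D2 : is_derive x 1 (id * rsum c) (x *: rsum (dcoef c) x + rsum c x *: 1).
    by apply: is_deriveM; exact: rsum_is_derive.
  have EF : rsum (fun j => if j is i.+1 then c i else 0) = (id * rsum c).
    by apply/funext => t; rewrite (rsum_shift _ ec).
  rewrite EF in D1; have [_ E1] := D1; have [_ E2] := D2.
  rewrite -E1 E2 in dx; rewrite -dx.
  by rewrite -[_ *: 1]/(_ * 1) mulr1 addrC.
pose phi t := q * rsum c t + t * rsum (dcoef c) t.
have cphi : continuous phi.
  move=> t; apply: cvgD; apply: cvgM; first exact: cvg_cst.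
  - exact: rsum_continuous.
  - exact: cvg_id.
  - exact: rsum_continuous.
have phi0 : 0 < phi 0 by rewrite /phi mul0r addr0 mulr_gt0 // cpos // lexx.
have phix : phi x <= 0.
  have cx := cpos x; rewrite (ltW x0) xs in cx.
  have -> : phi x = (q - 1) * rsum c x by rewrite /phi -[RHS]addr0 -dx; ring.
  by apply: mulr_le0_ge0; [rewrite subr_le0 | apply: ltW; exact: cx].
have [r [/andP[r0 rx] fr] pos] := first_zero cphi phi0 x0 phix.
by exists r => //; rewrite r0 (le_lt_trans rx).
Qed.

(** * Positivity of the Gamma factor *)

(** [t `^ a <= 1 + t <= 2 exp (t / 2)]. *)
Lemma gamma_integrand_le (R : realType) (a t : R) : 0 <= a <= 1 -> 0 < t ->
  t `^ a * expR (- t) <= 4 * exponential_pdf (1 / 2) t.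
Proof.
move=> /andP[a0 a1] t0; rewrite exponential_pdfE ?(ltW t0) //.
have E1 : t `^ a <= 1 + t.
  have [t1|t1] := leP t 1.
    apply: (@le_trans _ _ (1 `^ a)); last by rewrite powR1 lerDl ltW.
    by apply: ge0_ler_powR => //; rewrite nnegrE // ltW.
  apply: (@le_trans _ _ (t `^ 1)); first by rewrite ler_powR // ltW.
  by rewrite powRr1 ?lerDr // ltW.
have E2 : 1 + t / 2 <= expR (t / 2) by exact: expR_ge1Dx.
have -> : - t = - (t / 2) + - (t / 2) by field.
rewrite expRD (_ : - (1 / 2) * t = - (t / 2)); last by field.
have e0 : 0 < expR (- (t / 2)) by exact: expR_gt0.
rewrite 2!mulrA ler_pM2r //.
have : expR (t / 2) * expR (- (t / 2)) = 1 by rewrite -expRD subrr expR0.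
move: (t `^ a) (expR (t / 2)) (expR (- (t / 2))) E1 E2 e0 => u v w E1 E2 e0 E3.
have : u * w <= 2 * v * w by rewrite ler_pM2r //; lra.
by rewrite -mulrA E3; lra.
Qed.

(** [Gamma] is a real-valued integral, so its positivity includes its finiteness. *)
Lemma Gamma_gt0 (R : realType) (x : R) : 1 <= x <= 2 -> 0 < Gamma x.
Proof.
move=> x12; have a01 : 0 <= x - 1 <= 1 by lra.
pose f (t : R) := t `^ (x - 1) * expR (- t).
have mf : measurable_fun [set: R] (EFin \o f).
  apply/measurable_EFinP; apply: measurable_funM; first exact: measurable_powR.
  by apply: measurableT_comp; [exact: measurable_expR|exact: oppr_measurable].
have f0 (t : R) : (0%R <= (f t)%:E)%E.
  by rewrite /= lee_fin mulr_ge0 ?powR_ge0 ?expR_ge0.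
rewrite /Gamma /Rintegral fine_gt0 //; apply/andP; split.
  (* on [1, 2] the integrand is at least exp (- 2) *)
  apply: (@lt_le_trans _ _
    (\int[lebesgue_measure]_(t in `[1%R, 2%R]) (f t)%:E)%E); last first.
    apply: ge0_subset_integral => //.
      by apply: measurable_funTS.
    move=> t /=; rewrite !in_itv /= => /andP[t1 _]; rewrite andbT.
    exact: lt_le_trans t1.
  apply: (@lt_le_trans _ _ (\int[lebesgue_measure]_(t in `[1%R, 2%R])
    (cst (expR (- 2%R))%:E : R -> \bar R) t)%E).
    rewrite integral_cst // mule_gt0 ?lte_fin ?expR_gt0 //.
    have := lebesgue_measure_itv (`[1%R, 2%R] : interval R).
    rewrite /= lte_fin ltr1n => E; rewrite [ltRHS]E.
    by rewrite -EFinB lte_fin subr_gt0 ltr1n.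
  apply: ge0_le_integral => //.
  - by move=> t _; rewrite lee_fin expR_ge0.
  - by apply: measurable_funTS.
  move=> t /=; rewrite in_itv /= => /andP[t1 t2]; rewrite lee_fin.
  rewrite -[leLHS]mul1r; apply: ler_pM; rewrite ?expR_ge0 //.
    apply: (@le_trans _ _ (1 `^ (x - 1))); first by rewrite powR1.
    by apply: ge0_ler_powR => //; rewrite ?nnegrE //; [case/andP: a01|exact: le_trans t1].
  by rewrite ler_expR lerN2.
have I := @integrable_exponential_pdf R (1 / 2) ltac:(lra).
have I4 := integrableZl measurableT 4 I.
have ID : lebesgue_measure.-integrable (`]0, +oo[%classic : set R)
    (fun t : R => (4%:E * (EFin \o exponential_pdf (1 / 2)) t)%E).
  exact: integrableS I4.
apply: (@le_lt_trans _ _ (\int[lebesgue_measure]_(t in `]0%R, +oo[)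
    (4%:E * (EFin \o exponential_pdf (1 / 2)) t))%E); last first.
  by apply: (integrable_lty _ ID).
apply: ge0_le_integral => //.
- by move=> t _; exact: f0.
- exact: (measurable_funTS mf).
- exact: measurable_int ID.
move=> t /=; rewrite in_itv /= andbT => t0; rewrite -EFinM lee_fin.
exact: gamma_integrand_le.
Qed.

(** * Radii of convexity *)

Lemma hyp1F2_term (K : numFieldType) (c z : K) n :
  pochhammer 1 n / (pochhammer (3 / 2) n * pochhammer c n)
    * ((- (z / 4)) ^+ n / n`!%:R) =
  (-1) ^+ n * (\prod_(k < n) (4 * (c + k%:R) * (k%:R + 3 / 2))^-1) * z ^+ n.
Proof.
elim: n => [|n IH].
  by rewrite /pochhammer !big_ord0 !expr0 fact0 !mul1r !invr1 !mulr1.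
have n0 : n.+1%:R != 0 :> K by rewrite pnatr_eq0.
have P (a : K) : pochhammer a n.+1 = pochhammer a n * (a + n%:R).
  by rewrite /pochhammer big_ord_recr.
rewrite !P !exprS factS natrM big_ord_recr /=.
rewrite nat1r -[RHS]/((-1 * (-1) ^+ n) * _ * _).
transitivity ((-1) * (n%:R + 3 / 2)^-1 * (c + n%:R)^-1 * 4^-1 * z *
   (pochhammer 1 n / (pochhammer (3 / 2) n * pochhammer c n)
     * ((- (z / 4)) ^+ n / n`!%:R))).
  rewrite !invfM [3 / 2 + _]addrC.
  move: (pochhammer _ _)^-1 (pochhammer _ _)^-1 (c + _)^-1 (_ + 3/2)^-1 => p q r s.
  move: (n`!%:R^-1) (_ ^+ n) (pochhammer 1 n) (n.+1%:R) n0 => u v a m m0.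
  by field.
by rewrite IH !invfM; ring.
Qed.

Lemma g_coef_term (R : realType) (nu x : R) n :
  pochhammer 1 n / (pochhammer (3 / 2) n * pochhammer (nu + 3 / 2) n)
    * ((- (x / 4)) ^+ n / n`!%:R) = g_coef (nu + 1 / 2) n * x ^+ n.
Proof.
rewrite hyp1F2_term; congr (_ * _ * _); apply: eq_bigr => k _.
by congr (_ ^-1); rewrite -natr1; field.
Qed.

Lemma g_coef_termC (R : realType) (nu : R) (z : Cx R) n :
  pochhammer 1 n / (pochhammer (3 / 2) n * pochhammer (nu + 3 / 2)%:C n)
    * ((- (z / 4)) ^+ n / n`!%:R) = cterm (g_coef (nu + 1 / 2)) z n.
Proof.
rewrite hyp1F2_term /cterm; congr (_ * _).
rewrite /g_coef rmorphM rmorphXn rmorphN1 rmorph_prod; congr (_ * _).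
apply: eq_bigr => k _; rewrite fmorphV; congr (_ ^-1).
have -> : 4 * (nu + 1 / 2 + k.+1%:R) * (k.+1%:R + 1 / 2) =
   4 * (nu + 3 / 2 + k%:R) * (k%:R + 3 / 2) by rewrite -natr1; field.
by rewrite !rmorphM !rmorphD rmorphM fmorphV !rmorph_nat.
Qed.

Lemma hyp1F2_csum (R : realType) (nu : R) (z : Cx R) :
  hyp1F2 1 (3 / 2) (nu + 3 / 2)%:C (- (z / 4)) = csum (g_coef (nu + 1 / 2)) z.
Proof.
rewrite csumE /hyp1F2; congr (limn (series _)).
by apply/funext => n; exact: g_coef_termC.
Qed.

Lemma struvew_csum (R : realType) (nu : R) : 0 <= nu + 1 / 2 ->
  struvew nu = csum (w_coef (nu + 1 / 2)).
Proof.
move=> mu0; apply/funext => z; rewrite /struvew hyp1F2_csum.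
by rewrite -csum_shift //; exact: entire_g_coef.
Qed.

Lemma derive1_csum (R : realType) (c : nat -> R) : entire c ->
  derive1 (csum c) = csum (dcoef c).
Proof.
move=> ec; apply/funext => z; rewrite derive1E.
by have [_ ->] := csum_is_derive z ec.
Qed.

Lemma cvg_radius_csum (R : realType) (c : nat -> R) r : entire c ->
  (r%:E < cvg_radius (csum c))%E.
Proof.
move=> ec; apply: (@lt_le_trans _ _ (Num.max r 0 + 1)%:E).
  by rewrite lte_fin; apply: (@le_lt_trans _ _ (Num.max r 0)); rewrite ?ltrDl // le_max lexx.
apply: ereal_sup_ubound; exists (Num.max r 0 + 1) => //; split.
  by rewrite addr_ge0 // le_max lexx orbT.
by exists (fun n => (c n)%:C) => z _; exact: csum_cvg.
Qed.

Lemma cmodV (R : realType) (z : Cx R) : cmod z^-1 = (cmod z)^-1.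
Proof. by apply: complexI; rewrite -cmodE normfV cmodE fmorphV. Qed.

Lemma Re_ge_cmod (R : realType) (z : Cx R) : - cmod z <= complex.Re z.
Proof.
have : `|complex.Re z| <= cmod z by rewrite -realC_le -cmodE; exact: normc_ge_Re.
by rewrite ler_norml => /andP[].
Qed.

(** [Re (1 + w) >= 1 - |w| = (1 + b) q + a - |w| > b |w| + a]. *)
Lemma quotient_bound_ucv (R : realType) (a b q : R) (w : Cx R) : 0 <= b ->
    (1 + b) * q = 1 - a -> cmod w < q ->
  b * complex.Re `|w| + a < complex.Re (1 + w).
Proof.
move=> b0 E wq; have := Re_ge_cmod w.
have -> : complex.Re (1 + w) = 1 + complex.Re w by case: w {wq}.
by rewrite -/(cmod w); nra.
Qed.

(** [struve_bound] at the radius [|z|]. *)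
Lemma csum_quotient_lt (R : realType) (mu q r : R) (z : Cx R) : 0 <= mu <= 1 ->
    (forall t, 0 <= t < r -> 0 < rsum (dw_coef mu) t) ->
    (forall t, 0 <= t < r ->
       0 < q * rsum (dw_coef mu) t + t * rsum (dcoef (dw_coef mu)) t) ->
    cmod z < r ->
  csum (dw_coef mu) z != 0 /\
  cmod (z * csum (dcoef (dw_coef mu)) z / csum (dw_coef mu) z) < q.
Proof.
move=> mu01 fpos phipos zr; have z0 := cmod_ge0 z.
have zI : 0 <= cmod z < r by rewrite z0.
have [x|h1 h2] := struve_bound mu01 (lexx (cmod z)).
  by move=> /andP[x0 xz]; apply: fpos; rewrite x0 (le_lt_trans xz).
have fz := fpos _ zI; have pz := phipos _ zI.
have cz : 0 < cmod (csum (dw_coef mu) z) by exact: lt_le_trans h1.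
split.
  apply/eqP => E; move: cz; rewrite E (_ : cmod 0 = 0) ?ltxx //.
  by apply: complexI; rewrite -cmodE normr0.
rewrite cmodM cmodV ltr_pdivrMr //.
have h3 : - (cmod z * rsum (dcoef (dw_coef mu)) (cmod z)) <
    q * rsum (dw_coef mu) (cmod z) by rewrite -subr_gt0 opprK.
have := le_lt_trans h2 (_ : _ < q * rsum (dw_coef mu) (cmod z) * cmod (csum (dw_coef mu) z)).
rewrite ltr_pM2r // => /(_ h3); rewrite mulrAC ltr_pM2r //.
Qed.

(** No larger disc is admissible since at [z = r] the quotient is [- q], for which
[Re (1 - q) = b q + a]. *)
Lemma ucv_radius_csum (R : realType) (mu a b q r : R) : 0 <= mu <= 1 -> 0 <= b ->
    (1 + b) * q = 1 - a -> 0 < r ->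
    (forall t, 0 <= t <= r -> 0 < rsum (dw_coef mu) t) ->
    q * rsum (dw_coef mu) r + r * rsum (dcoef (dw_coef mu)) r = 0 ->
    (forall t, 0 <= t < r ->
       0 < q * rsum (dw_coef mu) t + t * rsum (dcoef (dw_coef mu)) t) ->
  uniform_convexity_radius b a (csum (w_coef mu)) = r%:E.
Proof.
move=> mu01 b0 E r0 fpos phir phipos; have /andP[mu0 _] := mu01.
have ew := entire_w_coef mu0; have ef := entire_dw_coef mu0.
have D1 : derive1 (csum (w_coef mu)) = csum (dw_coef mu) by rewrite derive1_csum.
have D2 : derive1 (csum (dw_coef mu)) = csum (dcoef (dw_coef mu)).
  by rewrite derive1_csum.
apply/eqP; rewrite eq_le; apply/andP; split.
  apply: ge_ereal_sup => _ [s [s0 _ H] <-]; rewrite lee_fin leNgt; apply/negP => rs.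
  have [] := H r%:C; first by rewrite normC_real ltcR gtr0_norm.
  move=> _; rewrite /convexity_quotient D1 D2.
  have fr : rsum (dw_coef mu) r != 0 by rewrite gt_eqF // fpos // lexx ltW.
  have -> : r%:C * csum (dcoef (dw_coef mu)) r%:C / csum (dw_coef mu) r%:C = (- q)%:C :> Cx R.
    rewrite !csum_real //; last exact: entire_dcoef.
    rewrite realCM -fmorphV /= -[LHS]/(_%:C * _%:C : Cx R) realCM; congr (_%:C).
    have -> : r * rsum (dcoef (dw_coef mu)) r = - q * rsum (dw_coef mu) r.
      by rewrite mulNr; apply/eqP; rewrite -addr_eq0 addrC phir.
    by rewrite mulfK.
  rewrite normC_real /= => h.
  have := ler_norm (- q); have := ler_norm q; rewrite normrN in h *.
  nra.
apply: ereal_sup_ubound; exists r => //; split => //.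
  exact: cvg_radius_csum.
move=> z; rewrite cmodE ltcR => zr; rewrite /convexity_quotient D1 D2.
have [|f0 fq] := csum_quotient_lt mu01 _ phipos zr.
  by move=> t /andP[t0 tr]; apply: fpos; rewrite t0 ltW.
by split => //; exact: quotient_bound_ucv fq.
Qed.

Lemma convexity_radius_ucv (R : realType) (f : Cx R -> Cx R) :
  convexity_radius f = uniform_convexity_radius 0 0 f.
Proof.
congr (ereal_sup _); congr (image _ _); apply/seteqP; split => r [r0 rc H]; split => // z zr.
  by have := H z zr; rewrite mul0r addr0.
by have := H z zr; rewrite mul0r addr0.
Qed.

(** * The Struve function on the half-line *)

Definition struve_cst (R : realType) (nu : R) : R :=
  (2^-1) `^ (nu + 1) / (Num.sqrt (pi / 4) * Gamma (nu + 3 / 2)).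

Lemma struve_cst_gt0 (R : realType) (nu : R) : `|nu| <= 1 / 2 -> 0 < struve_cst nu.
Proof.
rewrite ler_norml => /andP[n1 n2]; apply: divr_gt0; first exact: powR_gt0.
apply: mulr_gt0; first by rewrite sqrtr_gt0 divr_gt0 // pi_gt0.
by apply: Gamma_gt0; apply/andP; split; lra.
Qed.

Lemma hyp1F2_rsum (R : realType) (nu x : R) : 0 <= nu + 1 / 2 ->
  hyp1F2 1 (3 / 2) (nu + 3 / 2) (- (x / 4)) = rsum (g_coef (nu + 1 / 2)) x.
Proof.
move=> mu0; rewrite rsumE; last exact: entire_g_coef.
rewrite /hyp1F2; congr (limn (series _)).
by apply/funext => n; exact: g_coef_term.
Qed.

Lemma struveHE (R : realType) (nu x : R) : 0 <= nu + 1 / 2 -> 0 < x ->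
  struveH nu x =
  struve_cst nu * (x `^ (nu - 1) * rsum (w_coef (nu + 1 / 2)) (x ^+ 2)).
Proof.
move=> mu0 x0; rewrite /struveH hyp1F2_rsum // (w_sum _ mu0) /struve_cst.
have -> : (x / 2) `^ (nu + 1) = x `^ (nu - 1) * x ^+ 2 * (2^-1) `^ (nu + 1).
  rewrite powRM ?invr_ge0 ?ltW //; congr (_ * _).
  rewrite -powR_mulrn ?ltW // -powRD; last by rewrite (gt_eqF x0) implybT.
  by congr (_ `^ _); ring.
by ring.
Qed.

Lemma powR_rsum_is_derive (R : realType) (c : nat -> R) (p x : R) : entire c -> 0 < x ->
  is_derive x 1 (fun t => t `^ p * rsum c (t ^+ 2))
    (p * x `^ (p - 1) * rsum c (x ^+ 2)
     + 2 * (x `^ (p - 1) * x ^+ 2) * rsum (dcoef c) (x ^+ 2)).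
Proof.
move=> ec x0.
have D1 : is_derive x 1 (fun t : R => t `^ p) (p * x `^ (p - 1)).
  exact: is_derive1_powR.
have D2 : is_derive x 1 (fun t : R => t ^+ 2) (2 * x).
  have -> : 2 * x = x * 1 + x * 1 by ring.
  exact: (is_deriveM (is_derive_id x (1 : R)) (is_derive_id x (1 : R))).
have D3 : is_derive x 1 (fun t => rsum c (t ^+ 2)) (rsum (dcoef c) (x ^+ 2) * (2 * x)).
  have D := rsum_is_derive (x ^+ 2) ec.
  exact: (@is_derive1_comp _ (rsum c) (fun t => t ^+ 2)).
have E : x `^ p = x `^ (p - 1) * x.
  rewrite -[X in _ * X](powRr1 (ltW x0)) -powRD; last by rewrite (gt_eqF x0) implybT.
  by rewrite subrK.
have -> : p * x `^ (p - 1) * rsum c (x ^+ 2) +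
    2 * (x `^ (p - 1) * x ^+ 2) * rsum (dcoef c) (x ^+ 2) =
    x `^ p * (rsum (dcoef c) (x ^+ 2) * (2 * x)) +
    rsum c (x ^+ 2) * (p * x `^ (p - 1)) by rewrite E; ring.
exact: (is_deriveM D1 D3).
Qed.

(** With [A = x `^ (nu - 3)], [W], [f], [f'] the values at [x ^ 2] of [w] and of
its first two derivatives, the function and its first two derivatives are
polynomials in [x] with coefficients in [A W], [A f] and [A f']. *)
Lemma struveH_derive (R : realType) (nu x : R) : 0 <= nu + 1 / 2 -> 0 < x ->
  let k := struve_cst nu in let A := x `^ (nu - 3) in
  let W := rsum (w_coef (nu + 1 / 2)) (x ^+ 2) in
  let f := rsum (dw_coef (nu + 1 / 2)) (x ^+ 2) in
  let f' := rsum (dcoef (dw_coef (nu + 1 / 2))) (x ^+ 2) in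
  [/\ struveH nu x = k * A * (x ^+ 2 * W),
    derive1 (struveH nu) x = k * A * ((nu - 1) * x * W + 2 * x ^+ 3 * f) &
    derive1 (derive1 (struveH nu)) x = k * A *
      ((nu - 1) * (nu - 2) * W + (4 * nu - 2) * x ^+ 2 * f + 4 * x ^+ 4 * f')].
Proof.
move=> mu0 x0 /=; set mu := nu + 1 / 2 in mu0 *; set k := struve_cst nu.
have ew := entire_w_coef mu0; have ef := entire_dw_coef mu0.
have PX (t p q : R) n : 0 < t -> q = p + n%:R -> t `^ q = t `^ p * t ^+ n.
  move=> t0 ->; rewrite powRD; last by rewrite (gt_eqF t0) implybT.
  by rewrite powR_mulrn // ltW.
pose H1 t := k * ((nu - 1) * (t `^ (nu - 2) * rsum (w_coef mu) (t ^+ 2)) +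
  2 * (t `^ nu * rsum (dw_coef mu) (t ^+ 2))).
have nearpos (t : R) : 0 < t -> (\forall s \near t, 0 < s)%classic.
  by move=> t0; exact: lt_nbhsr.
have dH (t : R) : 0 < t -> is_derive t 1 (struveH nu) (H1 t).
  move=> t0.
  have D := powR_rsum_is_derive (nu - 1) ew t0.
  have E : H1 t = k * ((nu - 1) * t `^ (nu - 1 - 1) * rsum (w_coef mu) (t ^+ 2)
     + 2 * (t `^ (nu - 1 - 1) * t ^+ 2) * rsum (dcoef (w_coef mu)) (t ^+ 2)).
    have -> : nu - 1 - 1 = nu - 2 by ring.
    rewrite /H1 (PX t (nu - 2) nu 2%N t0); first by rewrite -/(dw_coef mu); ring.
    by rewrite subrK.
  rewrite E; apply: near_eq_is_derive (is_deriveZ k D).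
  apply: filterS (nearpos t t0) => s s0 /=.
  by rewrite (struveHE mu0 s0).
have d1 (t : R) : 0 < t -> derive1 (struveH nu) t = H1 t.
  by move=> t0; rewrite derive1E; have [_ ->] := dH t t0.
have X1 : x `^ (nu - 2) = x `^ (nu - 3) * x.
  by rewrite -[X in _ * X]expr1; apply: PX => //; ring.
have X2 : x `^ (nu - 1) = x `^ (nu - 3) * x ^+ 2 by apply: PX => //; ring.
have X3 : x `^ nu = x `^ (nu - 3) * x ^+ 3 by apply: PX => //; ring.
split.
- by rewrite (struveHE mu0 x0) X2 -/mu -/k; ring.
- by rewrite (d1 x x0) /H1 X1 X3; ring.
rewrite derive1E.
have D1 := powR_rsum_is_derive (nu - 2) ew x0.
have D2 := powR_rsum_is_derive nu ef x0.
have D := is_deriveZ k (is_deriveD (is_deriveZ (nu - 1) D1) (is_deriveZ 2 D2)).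
have {}D := @near_eq_is_derive _ _ _ _ (derive1 (struveH nu)) _ _ _ _ D.
have [|_ ->] := D.
  by apply: filterS (nearpos x x0) => s s0 /=; rewrite (d1 s s0).
rewrite -[LHS]/(k * ((nu - 1) * _ + 2 * _)).
have -> : nu - 2 - 1 = nu - 3 by ring.
rewrite X2 -/(dw_coef mu); ring.
Qed.

(** With [r = x ^ 2] the fraction in the equation, times [x], equals
[nu + 1 + 2 r f' / f]. *)
Lemma ucv_equation_rsum (R : realType) (nu a b r : R) : `|nu| <= 1 / 2 -> 0 < r ->
  let f := rsum (dw_coef (nu + 1 / 2)) r in
  let f' := rsum (dcoef (dw_coef (nu + 1 / 2))) r in
  ucv_equation nu a b r <-> f != 0 /\ (1 - a) * f + (1 + b) * (r * f') = 0.
Proof.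
move=> nu12 r0 /=; have k0 := struve_cst_gt0 nu12.
have mu0 : 0 <= nu + 1 / 2 by move: nu12; rewrite ler_norml => /andP[]; lra.
rewrite /ucv_equation; set x := Num.sqrt r.
have x0 : 0 < x by rewrite sqrtr_gt0.
have xr : x ^+ 2 = r by rewrite sqr_sqrtr // ltW.
have [-> -> ->] := struveH_derive mu0 x0.
rewrite xr; set W := rsum (w_coef _) _; set f := rsum (dw_coef _) _; set f' := rsum _ _.
have A0 : 0 < x `^ (nu - 3) by exact: powR_gt0.
set A := x `^ _ in A0 *; set k := struve_cst nu in k0 *.
clearbody W f f' A k x.
have -> : (1 - nu) * (k * A * (r * W)) +
    x * (k * A * ((nu - 1) * x * W + 2 * x ^+ 3 * f)) = 2 * k * A * x ^+ 4 * f.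
  by rewrite -xr; ring.
have -> : (2 - nu) * (k * A * ((nu - 1) * x * W + 2 * x ^+ 3 * f)) +
    x * (k * A * ((nu - 1) * (nu - 2) * W + (4 * nu - 2) * r * f + 4 * x ^+ 4 * f'))
    = 2 * k * A * ((nu + 1) * x ^+ 3 * f + 2 * x ^+ 5 * f').
  by rewrite -xr; ring.
have c0 : 2 * k * A * x ^+ 4 != 0.
  rewrite gt_eqF // mulr_gt0 ?exprn_gt0 // mulr_gt0 //.
  exact: mulr_gt0.
rewrite mulf_eq0 negb_or c0 /=.
suff E : f != 0 -> 2 * (1 - a) - (1 + b) * (1 + nu - x *
   (2 * k * A * ((nu + 1) * x ^+ 3 * f + 2 * x ^+ 5 * f') / (2 * k * A * x ^+ 4 * f)))
   = 2 * ((1 - a) * f + (1 + b) * (r * f')) / f.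
  split=> -[f0 h]; split => //.
    apply/eqP; move/eqP: h; rewrite E // mulf_eq0 invr_eq0 (negbTE f0) orbF.
    by rewrite mulf_eq0 pnatr_eq0.
  by rewrite E // h mulr0 mul0r.
move=> f0; rewrite -xr; field.
by rewrite f0 (gt_eqF k0) (gt_eqF A0) (gt_eqF x0).
Qed.

Lemma struveH_eq0 (R : realType) (nu x : R) : `|nu| <= 1 / 2 -> 0 < x ->
  struveH nu x = 0 <-> rsum (g_coef (nu + 1 / 2)) (x ^+ 2) = 0.
Proof.
move=> nu12 x0; have k0 := struve_cst_gt0 nu12.
have mu0 : 0 <= nu + 1 / 2 by move: nu12; rewrite ler_norml => /andP[]; lra.
rewrite (struveHE mu0 x0) (w_sum _ mu0); split=> [/eqP|->]; last by rewrite !mulr0.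
rewrite mulf_eq0 (gt_eqF k0) mulf_eq0 (gt_eqF (powR_gt0 _ x0)) /=.
by rewrite mulf_eq0 expf_eq0 (gt_eqF x0) => /eqP.
Qed.

(** * Order of the radii and zeros *)

Unset Implicit Arguments.

Theorem theorem2p6 (R : realType) (nu alpha beta : R)
    (hnu : `|nu| <= 1 / 2) (halpha : 0 <= alpha < 1) (hbeta : 0 <= beta) :
  exists r sigma h : R,
    [/\ smallest_positive (ucv_equation nu alpha beta) r,
        smallest_positive
          (fun x : R => derive1 (struvew nu) x%:C = 0) sigma &
        smallest_positive (fun x : R => struveH nu x = 0) h] /\
    [/\ uniform_convexity_radius beta alpha (struvew nu) = r%:E,
        0 < alpha \/ 0 < beta ->
          (uniform_convexity_radius beta alpha (struvew nu)
             < convexity_radius (struvew nu))%E,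
        (convexity_radius (struvew nu) < sigma%:E)%E &
        sigma < h ^+ 2].
Proof.
have mu01 : 0 <= nu + 1 / 2 <= 1 by move: hnu; rewrite ler_norml => /andP[]; lra.
have /andP[mu0 _] := mu01; have /andP[a0 a1] := halpha.
have b1 : 0 < 1 + beta by lra.
pose q := (1 - alpha) / (1 + beta).
have qE : (1 + beta) * q = 1 - alpha by rewrite mulrC divfK // gt_eqF.
have q01 : 0 < q <= 1.
  by rewrite divr_gt0 ?subr_gt0 //= ler_pdivrMr // mul1r; lra.
have q1 : 0 < alpha \/ 0 < beta -> q < 1.
  by move=> ab; rewrite ltr_pdivrMr // mul1r; case: ab => ?; lra.
set mu := nu + 1 / 2 in mu01 mu0.
have [hz [sigma [/andP[s0 sh] gh gpos fs fpos]]] := struve_zeros mu01.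
have ef := entire_dw_coef mu0.
have one01 : 0 < (1 : R) <= 1 by rewrite ltr01 lexx.
have [r [/andP[r0 rs] phir] phipos] := quotient_root ef q01 s0 fs fpos.
have [rc [/andP[rc0 rcs] phirc] phicpos] := quotient_root ef one01 s0 fs fpos.
have fle t y : y < sigma -> 0 <= t <= y -> 0 < rsum (dw_coef mu) t.
  by move=> ys /andP[t0 ty]; apply: fpos; rewrite t0 (le_lt_trans ty).
have Rq : uniform_convexity_radius beta alpha (struvew nu) = r%:E.
  rewrite (struvew_csum mu0).
  by apply: (ucv_radius_csum mu01 hbeta qE r0 _ phir phipos) => t; exact: fle.
have Rc : convexity_radius (struvew nu) = rc%:E.
  rewrite (struvew_csum mu0) convexity_radius_ucv.
  apply: (ucv_radius_csum mu01 (lexx 0) _ rc0 _ phirc phicpos); first by ring.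
  by move=> t; exact: fle.
have D1 : derive1 (struvew nu) = csum (dw_coef mu).
  by rewrite (struvew_csum mu0) derive1_csum //; exact: entire_w_coef.
have h0 : 0 < hz by exact: lt_trans sh.
exists r, sigma, (Num.sqrt hz); split; split.
- split; [exact: r0| |].
    apply/(ucv_equation_rsum alpha beta hnu r0); split.
      by rewrite gt_eqF // (fle r r) // lexx ltW.
    by rewrite -qE -mulrA -mulrDr phir mulr0.
  move=> s sp /(ucv_equation_rsum alpha beta hnu sp) [_ E].
  rewrite leNgt; apply/negP => sr.
  have := phipos s; rewrite (ltW sp) sr => /(_ isT).
  rewrite -(pmulr_rgt0 _ b1) mulrDr mulrA qE E ltxx.
  by [].
- split; [exact: s0| |].
    by rewrite D1 (csum_real _ ef) fs.
  move=> s sp; rewrite D1 (csum_real _ ef) => /complexI E.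
  rewrite leNgt; apply/negP => ss.
  by have := fpos s; rewrite (ltW sp) ss E ltxx => /(_ isT).
- split; first by rewrite sqrtr_gt0.
    apply/(struveH_eq0 hnu); first by rewrite sqrtr_gt0.
    by rewrite (sqr_sqrtr (ltW h0)); exact: gh.
  move=> s sp /(struveH_eq0 hnu sp) E.
  rewrite -(ler_pXn2r (_ : 0 < 2)%N) ?nnegrE ?sqrtr_ge0 ?(ltW sp) //.
  rewrite (sqr_sqrtr (ltW h0)) leNgt; apply/negP => ss.
  have := gpos (s ^+ 2); rewrite sqr_ge0 ss => /(_ isT).
  by rewrite E ltxx.
- exact: Rq.
- rewrite Rq Rc lte_fin => ab.
  (* at the radius of convexity [q f + x f'] equals [(q - 1) f], which is negative *)
  have neg : q * rsum (dw_coef mu) rc + rc * rsum (dcoef (dw_coef mu)) rc < 0.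
    have fc : 0 < rsum (dw_coef mu) rc by apply: (fle rc rc rcs); rewrite lexx ltW.
    rewrite -[X in _ + X](addrK (1 * rsum (dw_coef mu) rc)) [X in _ + (X - _)]addrC phirc.
    by rewrite sub0r -mulrBl nmulr_rlt0 // subr_lt0 q1.
  rewrite lt_neqAle; apply/andP; split.
    by apply/eqP => E; move: neg; rewrite -E phir ltxx.
  rewrite leNgt; apply/negP => rr.
  have := phipos rc; rewrite (ltW rc0) rr => /(_ isT).
  by rewrite ltNge (ltW neg).
- by rewrite Rc lte_fin.
- by rewrite (sqr_sqrtr (ltW h0)).
Qed.
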